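(* There exists a family $(Z_t)_{t\ge 0}$ of $\mathbb{Z}^+$-valued random variables, each $Z_t$ being a measurable function of the trapping landscape $\sigma$, such that, as $t\to\infty$, \[ P_\sigma(X_t = Z_t)\to 1 \quad\text{in } \mathbf{P}\text{-probability}. \]
   Context: Let $\mathbb{Z}^+=\{0,1,2,\dots\}$. Let $\sigma=(\sigma_x)_{x\in\mathbb{Z}^+}$ be i.i.d. strictly positive random variables on a probability space with probability measure $\mathbf{P}$ (the trapping landscape). Define $L(u):=1/\mathbf{P}(\sigma_0>u)$ (non-decreasing, unbounded, càdlàg) and assume it is slowly varying: $\lim_{u\to\infty}L(uv)/L(u)=1$ for all $v>0$. Conditional on $\sigma$, $X=(X_t)_{t\ge0}$ (the Bouchaud trap model) is the continuous-time Markov chain on $\mathbb{Z}^+$ started from $0$ which jumps from $x$ to each nearest neighbour $y$ of $x$ in $\mathbb{Z}^+$ at rate $1/(2\sigma_x)$ (and to no other site). $P_\sigma$ denotes the law of $X$ conditional on $\sigma$ (the quenched law). *)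

(* Defs.v *)
From HB Require Import structures.
From mathcomp Require Import all_boot all_order all_algebra.
From mathcomp Require Import all_classical all_reals all_analysis.
Set Implicit Arguments. Unset Strict Implicit. Unset Printing Implicit Defensive.
Import Order.TTheory GRing.Theory Num.Theory.
Import numFieldNormedType.Exports.
Local Open Scope classical_set_scope.
Local Open Scope ring_scope.

Definition btm_rate (R : realType) (s : nat -> R) (x : nat) : R :=
  (2 * s x)^-1.

(* total jump rate out of x : x has 1 neighbour in Z^+ if x = 0, 2 otherwise *)
Definition btm_qout (R : realType) (s : nat -> R) (x : nat) : R :=
  (if x == 0%N then 1 else 2) * btm_rate s x.

(* Iterates of the backward Kolmogorov integral equation
     p_{n+1}(t,x,y) = [x=y] e^{-q_x t}
        + \int_0^t e^{-q_x u} \sum_{z ~ x} r(x,z) p_n(t-u,z,y) du,   p_0 = 0.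
   p_n(t,x,y) = P_x(X_t = y, fewer than n jumps up to time t). *)
Fixpoint btm_iter (R : realType) (s : nat -> R) (n : nat) : R -> nat -> nat -> R :=
  match n with
  | 0%N => fun _ _ _ => 0
  | n'.+1 => fun t x y =>
      (if x == y then expR (- (btm_qout s x * t)) else 0) +
      Rintegral (@lebesgue_measure R) `[0, t]%classic
        (fun u => expR (- (btm_qout s x * u)) *
           (btm_rate s x * btm_iter s n' (t - u) x.+1 y +
            (if x == 0%N then 0 else btm_rate s x * btm_iter s n' (t - u) x.-1 y)))
  end.

(* Transition function of the (minimal) continuous-time Markov chain:
   P_s(X_t = y | X_0 = x) = lim_n p_n(t,x,y) (minimal solution of the
   backward equation). *)
Definition btm_trans (R : realType) (s : nat -> R) (t : R) (x y : nat) : R :=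
  limn (fun n => btm_iter s n t x y).

Definition btm_prob (R : realType) (s : nat -> R) (t : R) (y : nat) : R :=
  btm_trans s t 0%N y.

Definition iid_indep d (T : measurableType d) (R : realType)
  (P : probability T R) (X : nat -> T -> R) : Prop :=
  forall (I : seq nat) (B : nat -> set R), uniq I ->
    (forall i, i \in I -> measurable (B i)) ->
    P (\bigcap_(i in [set` I]) (X i @^-1` B i)) =
    (\prod_(i <- I) P (X i @^-1` B i))%E.

Definition ident_distr d (T : measurableType d) (R : realType)
  (P : probability T R) (X : nat -> T -> R) : Prop :=
  forall (i : nat) (B : set R), measurable B ->
    P (X i @^-1` B) = P (X 0%N @^-1` B).

Definition tailL d (T : measurableType d) (R : realType)
  (P : probability T R) (X : nat -> T -> R) (u : R) : R :=
  (fine (P [set w | u < X 0%N w]))^-1.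

Definition slowly_varying (R : realType) (L : R -> R) : Prop :=
  forall v : R, 0 < v -> (fun u => L (u * v) / L u) @ +oo --> (1 : R).

Definition landscape_sigma d (T : measurableType d) (R : realType)
  (X : nat -> T -> R) : set (set T) :=
  <<s [set A | exists (x : nat) (B : set R), measurable B /\ A = X x @^-1` B] >>.

(* Main.v *)
Require Import Defs.
From HB Require Import structures.
From mathcomp Require Import all_boot all_order all_algebra.
From mathcomp Require Import all_classical all_reals all_analysis.
From mathcomp Require Import measurable_realfun.
From mathcomp Require Import ring lra zify.
Import Order.TTheory GRing.Theory Num.Theory.
Import numFieldNormedType.Exports.
Local Open Scope classical_set_scope.
Local Open Scope ring_scope.
Set Implicit Arguments.
Unset Strict Implicit.
Unset Printing Implicit Defensive.

(**
Let Z be the first site whose trap exceeds a level l, chosen so that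
l / P(sigma > l) is of order t.

Quenched part.  Kill the chain outside [0, n) with n > Z and uniformize it: it
becomes a discrete chain run at the times of a Poisson process.  Its kernel is
reversible with respect to sigma, so the mass started at Z that is found at
x <> Z is at most sigma x / sigma Z; harmonic functions of the path bound the
exit rate by a multiple of 1 / (sigma Z * (n - Z)) and the mean time to reach
Z from 0 by 2 Z * sum_(j < Z) sigma j.  Averaging over the Poisson clock gives
  P(X_t = Z) >= 1 - sum_(x < n, x <> Z) sigma x / sigma Z
                  - t / (2 sigma Z (n - Z)) - 2 Z (sum_(j < Z) sigma j) / t.
The uniformized chain minorizes the Picard iterates defining the transition
function, by Duhamel's formula and induction on the number of jumps.

Annealed part.  Z is of order 1 / P(sigma > l), and by slow variation sigma Z
exceeds any fixed multiple of l.  A second exceedance close to Z is unlikely by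
pairwise independence, and the truncated mean of sigma at level l is
o(l P(sigma > l)), so that the other traps near Z add up to o(l).
*)

(** * The killed discrete chain *)

Section KilledChain.
Variables (R : realType) (s : nat -> R).
Hypothesis s_gt0 : forall x, 0 < s x.

(** The off-diagonal part of the generator, kept apart because it is monotone in [f] and is the term
    that the backward equation integrates. *)
Definition inflow (f : nat -> R) (x : nat) : R :=
  btm_rate s x * f x.+1 + (if x == 0%N then 0 else btm_rate s x * f x.-1).

Definition generator (f : nat -> R) (x : nat) : R :=
  inflow f x - btm_qout s x * f x.

Lemma btm_rate_gt0 x : 0 < btm_rate s x.
Proof. by rewrite /btm_rate invr_gt0 mulr_gt0. Qed.

Lemma btm_qout_gt0 x : 0 < btm_qout s x.
Proof. by rewrite /btm_qout mulr_gt0 ?btm_rate_gt0//; case: ifP. Qed.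

Lemma btm_qout_le x : btm_qout s x <= (s x)^-1.
Proof.
have sx := s_gt0 x.
rewrite /btm_qout /btm_rate invfM; have := invr_gt0 (s x); rewrite sx => h.
by case: ifP => _; lra.
Qed.

Lemma inflow_le (f g : nat -> R) x :
  f x.-1 <= g x.-1 -> f x.+1 <= g x.+1 -> inflow f x <= inflow g x.
Proof.
move=> h1 h2; have r0 := ltW (btm_rate_gt0 x).
rewrite /inflow lerD// ?ler_wpM2l//; case: ifP => // _.
by rewrite ler_wpM2l.
Qed.

Lemma inflow_cst c x : inflow (fun=> c) x = btm_qout s x * c.
Proof. by rewrite /inflow /btm_qout; case: ifP => _; ring. Qed.

Lemma generatorE0 (f : nat -> R) :
  generator f 0 = btm_rate s 0 * (f 1%N - f 0%N).
Proof. by rewrite /generator /inflow /btm_qout /=; ring. Qed.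

Lemma generatorES (f : nat -> R) x :
  generator f x.+1 = btm_rate s x.+1 * (f x.+2 + f x - 2 * f x.+1).
Proof. by rewrite /generator /inflow /btm_qout /=; ring. Qed.

Variables (n : nat) (Lam : R).
Hypothesis Lam_gt0 : 0 < Lam.
Hypothesis Lam_ge : forall x, (x < n)%N -> (s x)^-1 <= Lam.

(** The uniformized operator [I + generator / Lam], killed outside [[0, n)]. On [[0, n)] the bound
    [1 / s x <= Lam] makes the holding probability [1 - btm_qout s x / Lam] nonnegative. *)
Definition kstep (f : nat -> R) (x : nat) : R :=
  if (x < n)%N then f x + Lam^-1 * generator f x else 0.

Lemma kstep_out f x : (n <= x)%N -> kstep f x = 0.
Proof. by rewrite /kstep leqNgt => /negbTE ->. Qed.

Lemma kstepE f x : (x < n)%N ->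
  kstep f x = (1 - btm_qout s x / Lam) * f x + Lam^-1 * inflow f x.
Proof. by rewrite /kstep /generator => ->; ring. Qed.

Lemma btm_qout_leL x : (x < n)%N -> btm_qout s x / Lam <= 1.
Proof.
move=> xn; rewrite ler_pdivrMr// mul1r.
exact: le_trans (btm_qout_le x) (Lam_ge xn).
Qed.

(** All coefficients of the step are nonnegative. Only [x] and its neighbours are compared, because
    the induction in [killed_at_lb] controls sites up to [z] only. *)
Lemma kstep_le f g x : f x.-1 <= g x.-1 -> f x <= g x -> f x.+1 <= g x.+1 ->
  kstep f x <= kstep g x.
Proof.
move=> h1 h2 h3; have [xn|xn] := ltnP x n; last by rewrite !kstep_out.
rewrite !kstepE// lerD//.
  by rewrite ler_wpM2l// subr_ge0 btm_qout_leL.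
by rewrite ler_wpM2l ?invr_ge0 ?(ltW Lam_gt0)// inflow_le.
Qed.

(** Reversibility with respect to [s], by a discrete Green identity: [s x * btm_rate s x] is
    constantly 1/2, so the sum telescopes to a Wronskian at the boundary, which vanishes with [f n]
    and [g n]. *)
Lemma kstep_symm (f g : nat -> R) : f n = 0 -> g n = 0 ->
  \sum_(x < n) s x * (kstep f x * g x) = \sum_(x < n) s x * (f x * kstep g x).
Proof.
move=> fn gn.
have wronskian m : \sum_(x < m.+1) s x * (generator f x * g x - f x * generator g x)
    = 2^-1 * (f m.+1 * g m - f m * g m.+1).
  elim: m => [|m IH].
    rewrite big_ord_recr big_ord0 /= !generatorE0 /btm_rate.
    by field; rewrite gt_eqF.
  rewrite big_ord_recr /= IH !generatorES /btm_rate.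
  by field; rewrite gt_eqF.
apply/eqP; rewrite -subr_eq0 -sumrB; apply/eqP.
rewrite (eq_bigr (fun x : 'I_n => Lam^-1 *
   (s x * (generator f x * g x - f x * generator g x)))).
  rewrite -mulr_sumr; case: n fn gn => [|m] fn gn; first by rewrite big_ord0 mulr0.
  by rewrite wronskian fn gn; ring.
by move=> i _; rewrite /kstep ltn_ord; ring.
Qed.

(** * Iterates of the killed kernel: survival, mass at the trap, hitting time *)

Variable z : nat.
Hypothesis zn : (z < n)%N.

(** As functions of the starting point [x]: the probabilities of being at [z], respectively of being
    still alive, after [m] steps. *)
Definition killed_at m : nat -> R := iter m kstep (fun x => (x == z)%:R).
Definition survival m : nat -> R := iter m kstep (fun x => (x < n)%N%:R).

Lemma killed_at_out m x : (n <= x)%N -> killed_at m x = 0.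
Proof.
move=> nx; case: m => [|m]; last by rewrite /killed_at iterS kstep_out.
by rewrite /killed_at /= gtn_eqF// (leq_trans zn).
Qed.

Lemma survival_out m x : (n <= x)%N -> survival m x = 0.
Proof.
move=> nx; case: m => [|m]; last by rewrite /survival iterS kstep_out.
by rewrite /survival /= ltnNge nx.
Qed.

Lemma kstep_ge0 f x : (forall y, 0 <= f y) -> 0 <= kstep f x.
Proof.
move=> f0; apply: le_trans (kstep_le (f := fun=> 0) _ _ _) => //.
by rewrite /kstep /generator inflow_cst; case: ifP => _ //; rewrite !mulr0 subrr mulr0 addr0.
Qed.

Lemma kstep_le1 f x : (forall y, f y <= 1) -> kstep f x <= 1.
Proof.
move=> f1; apply: (le_trans (kstep_le (g := fun=> 1) _ _ _)) => //.
by rewrite /kstep /generator inflow_cst; case: ifP => _ //; rewrite subrr mulr0 addr0.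
Qed.

Lemma killed_at_ge0 m x : 0 <= killed_at m x.
Proof.
elim: m x => [|m IH] x; first by rewrite /killed_at /= ler0n.
by rewrite /killed_at iterS; exact: kstep_ge0.
Qed.

Lemma killed_at_le1 m x : killed_at m x <= 1.
Proof.
elim: m x => [|m IH] x; first by rewrite /killed_at /= lern1; case: eqP.
by rewrite /killed_at iterS; exact: kstep_le1.
Qed.

(** Iterated reversibility: [s z * p_m(z, x) = s x * p_m(x, z)], summed over [x]. *)
Lemma survivalE m :
  s z * survival m z = \sum_(x < n) s x * killed_at m x.
Proof.
have H k f g : f n = 0 -> g n = 0 ->
    \sum_(x < n) s x * (iter k kstep f x * g x) =
    \sum_(x < n) s x * (f x * iter k kstep g x).
  elim: k f g => [//|k IH] f g fn gn.
  rewrite iterSr IH// ?kstep_out// kstep_symm//.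
  by case: k {IH} => [//|k]; rewrite iterS kstep_out.
have := H m (fun x => (x == z)%:R) (fun x => (x < n)%N%:R).
rewrite /= gtn_eqF// ltnn => /(_ erefl erefl) E.
transitivity (\sum_(x < n) s x * ((x == z :> nat)%:R * survival m x)).
  rewrite (bigD1 (Ordinal zn))//= eqxx mul1r big1 ?addr0// => i iz.
  by rewrite (_ : (i == z :> nat) = false) ?mul0r ?mulr0//; exact: negbTE.
by rewrite -E; apply: eq_bigr => i _; rewrite ltn_ord mulr1.
Qed.

(** A step from [z] to [z + 1] has probability [1 / (2 * Lam * s z)], and from there [n] is reached
    before [z] with probability [1 / (n - z)]. *)
Definition exit_rate : R := (2 * Lam * s z * (n - z)%:R)^-1.

(** With truncated subtraction, [1 - (x - z) / (n - z)] is harmonic on [[0, n)] except at [z], where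
    one step lowers it by [exit_rate]. Subtracting [m * exit_rate] gives a subsolution, which is
    nonpositive from [n] on. *)
Lemma survival_lb m x :
  1 - (x - z)%:R / (n - z)%:R - m%:R * exit_rate <= survival m x.
Proof.
have nz0 : 0 < (n - z)%:R :> R by rewrite ltr0n subn_gt0.
have c0 : 0 < exit_rate by rewrite invr_gt0 !mulr_gt0.
have out k y : (n <= y)%N ->
    1 - (y - z)%:R / (n - z)%:R - k%:R * exit_rate <= 0 :> R.
  move=> ny; have : 1 <= (y - z)%:R / (n - z)%:R :> R.
    by rewrite ler_pdivlMr// mul1r ler_nat leq_sub2r.
  have : 0 <= k%:R * exit_rate by rewrite mulr_ge0// ltW.
  lra.
elim: m x => [|m IH] x.
  have [nx|xn] := leqP n x; first by rewrite survival_out// out.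
  rewrite /survival /= xn mul0r subr0 gerBl.
  by rewrite divr_ge0.
have [nx|xn] := leqP n x; first by rewrite survival_out// out.
rewrite /survival iterS.
pose f y : R := 1 - (y - z)%:R / (n - z)%:R - m%:R * exit_rate.
apply: (le_trans _ (kstep_le (f := f) (IH _) (IH _) (IH _))).
rewrite /kstep xn -natr1 /f.
have Li0 : 0 <= Lam^-1 by rewrite invr_ge0 ltW.
suff : - (Lam * exit_rate) <=
  generator (fun x => 1 - (x - z)%:R / (n - z)%:R - m%:R * exit_rate) x.
  move=> /(ler_wpM2l Li0).
  by rewrite mulrN mulKf ?gt_eqF// mulrDl mul1r opprD !addrA lerD2l.
have -> : Lam * exit_rate = btm_rate s z * (n - z)%:R^-1.
  by rewrite /exit_rate /btm_rate; field; rewrite !gt_eqF.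
have D0 : 0 <= (n - z)%:R^-1 :> R by rewrite invr_ge0 ltW.
have rD : 0 <= btm_rate s z * (n - z)%:R^-1.
  by rewrite mulr_ge0// ltW// btm_rate_gt0.
case: x xn => [|x] xn.
  rewrite generatorE0; have [->|z0] := posnP z.
    by rewrite !subn0 le_eqVlt; apply/orP; left; apply/eqP => /=; ring.
  have /eqP -> : (1 - z == 0)%N by rewrite subn_eq0.
  by rewrite sub0n subrr mulr0 oppr_le0.
rewrite generatorES.
(* The second difference of the positive part of [x - z] is the indicator of [z]. *)
have : (x.+2 - z)%:R + (x - z)%:R = 2 * (x.+1 - z)%:R + (x.+1 == z)%:R :> R.
  rewrite -natrD -natrM -natrD; congr (_%:R).
  by case: eqP => ?; lia.
move: ((x.+2 - z)%:R) ((x - z)%:R) ((x.+1 - z)%:R) => A B C E.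
have -> : A = 2 * C + (x.+1 == z)%:R - B by rewrite -E; ring.
case: eqP => [<-|_]; last by rewrite [leRHS](_ : _ = 0) ?oppr_le0//=; ring.
by rewrite le_eqVlt; apply/orP; left; apply/eqP => /=; ring.
Qed.

Definition trap_error : R := (\sum_(x < n | x != z :> nat) s x) / s z.

(** The surviving mass started at [z] is at [z] or at some [x != z]; by [survivalE] and
    [killed_at_le1] the latter holds at most [s x / s z] each. *)
Lemma killed_at_trap m : 1 - trap_error - m%:R * exit_rate <= killed_at m z.
Proof.
have := survival_lb m z; rewrite subnn mul0r subr0 => /le_trans h.
have : survival m z <= killed_at m z + trap_error.
  rewrite -(ler_pM2l (s_gt0 z)) survivalE (bigD1 (Ordinal zn))//= mulrDr lerD2l.
  rewrite /trap_error mulrCA divff ?gt_eqF// mulr1 ler_sum// => i _.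
  by rewrite ger_pMr// killed_at_le1.
by move=> /h; lra.
Qed.

(* The mean number of steps from [x <= z] to [z]. *)
Definition hit_mean (x : nat) : R :=
  2 * Lam * \sum_(x <= y < z) \sum_(j < y.+1) s j.

Lemma hit_mean_ge0 x : 0 <= hit_mean x.
Proof.
rewrite mulr_ge0 ?sumr_ge0//; first by rewrite mulr_ge0// ltW.
by move=> i _; rewrite sumr_ge0// => j _; rewrite ltW.
Qed.

Lemma hit_mean_diff x : (x < z)%N ->
  hit_mean x - hit_mean x.+1 = 2 * Lam * \sum_(j < x.+1) s j.
Proof. by move=> xz; rewrite /hit_mean big_ltn//; ring. Qed.

Lemma hit_mean_ge1 x : (x < z)%N -> 1 <= hit_mean x.
Proof.
move=> xz; have := hit_mean_diff xz; have := hit_mean_ge0 x.+1.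
have : 1 <= Lam * s x.
  by rewrite -ler_pdivrMr// mul1r Lam_ge// (ltn_trans xz).
have : 0 <= Lam * \sum_(j < x) s j.
  by rewrite mulr_ge0 ?sumr_ge0// => [|i _]; exact: ltW.
rewrite big_ord_recr /=; lra.
Qed.

(** One step of the chain lowers the mean remaining number of steps by exactly one. *)
Lemma generator_hit_mean x : (x < z)%N -> generator hit_mean x = - Lam.
Proof.
case: x => [|x] xz.
  rewrite generatorE0; have := hit_mean_diff xz.
  rewrite big_ord_recr big_ord0 /= => /eqP; rewrite subr_eq => /eqP ->.
  by rewrite /btm_rate; field; rewrite gt_eqF.
rewrite generatorES; have := hit_mean_diff xz.
have := hit_mean_diff (ltnW xz).
rewrite [in X in _ -> X -> _]big_ord_recr /=.
move=> /eqP; rewrite subr_eq => /eqP -> /eqP; rewrite subr_eq => /eqP ->.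
by rewrite /btm_rate; field; rewrite gt_eqF.
Qed.

(** The term [hit_mean x / m.+1] is the Markov bound for not having reached [z] by step [m]; once
    there, [killed_at_trap] applies. The proof runs this as a first-step induction. *)
Lemma killed_at_lb m x : (x <= z)%N ->
  1 - trap_error - m%:R * exit_rate - hit_mean x / m.+1%:R <= killed_at m x.
Proof.
have c0 : 0 < exit_rate by rewrite invr_gt0 !mulr_gt0// ltr0n subn_gt0.
have B0 : 0 <= trap_error.
  by rewrite mulr_ge0 ?invr_ge0 ?sumr_ge0// => *; rewrite ltW.
have atz k : 1 - trap_error - k%:R * exit_rate - hit_mean z / k.+1%:R <= killed_at k z.
  by apply: le_trans (killed_at_trap k); rewrite gerBl divr_ge0 ?hit_mean_ge0.
elim: m x => [|m IH] x; rewrite leq_eqVlt => /predU1P[->//|xz].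
  rewrite mul0r divr1 subr0.
  have := hit_mean_ge1 xz; have := killed_at_ge0 0 x. by lra.
(* If [hit_mean x >= m + 2] the bound is nonpositive. Otherwise [(hit_mean x - 1) / (m + 1) <=
   hit_mean x / (m + 2)], which closes the induction. *)
have [le|/ltW ge] := leP (hit_mean x) m.+2%:R; last first.
  have : 1 <= hit_mean x / m.+2%:R by rewrite ler_pdivlMr ?mul1r.
  have := killed_at_ge0 m.+1 x.
  have : 0 <= m.+1%:R * exit_rate by rewrite mulr_ge0// ltW.
  by move: (_ * exit_rate) (hit_mean x / _) => u v; lra.
rewrite /killed_at iterS.
have xz1 : (x.-1 <= z)%N by rewrite (leq_trans (leq_pred x))// ltnW.
pose f y : R := 1 - trap_error - m%:R * exit_rate - hit_mean y / m.+1%:R.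
apply: (le_trans _ (kstep_le (f := f) (IH _ xz1) (IH _ (ltnW xz)) (IH _ xz))).
rewrite /kstep (ltn_trans xz)//.
have -> : generator f x = - m.+1%:R^-1 * generator hit_mean x.
  by case: (x) => [|y]; rewrite /f ?generatorE0 ?generatorES; ring.
rewrite generator_hit_mean// mulrNN mulrCA mulVf ?gt_eqF// mulr1 /f.
have : (hit_mean x - 1) / m.+1%:R <= hit_mean x / m.+2%:R.
  rewrite ler_pdivrMr// mulrAC ler_pdivlMr// -[m.+2%:R]natr1.
  by move: le; rewrite -[m.+2%:R]natr1; nra.
have : m%:R * exit_rate <= m.+1%:R * exit_rate by rewrite ler_pM2r ?ler_nat.
rewrite mulrBl mul1r.
move: (hit_mean x / m.+1%:R) (hit_mean x / m.+2%:R) (m.+1%:R^-1) => u v w.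
by move: (m.+1%:R * exit_rate) (m%:R * exit_rate) => c' c; lra.
Qed.

Lemma hit_mean0_le : hit_mean 0 <= 2 * Lam * (z%:R * \sum_(j < z) s j).
Proof.
rewrite ler_wpM2l// ?mulr_ge0// ?(ltW Lam_gt0)//.
have -> : z%:R * \sum_(j < z) s j = \sum_(i < z) \sum_(j < z) s j.
  by rewrite sumr_const card_ord mulr_natl.
rewrite big_mkord ler_sum// => i _.
rewrite (big_ord_widen z (fun j => s j))// big_mkcond ler_sum// => j _.
by case: ifP => // _; rewrite ltW.
Qed.

End KilledChain.

(** * Measurability of the iterates and the Duhamel formula *)

Section Iterates.
Variable R : realType.
Implicit Types (s : nat -> R).

Lemma btm_iterS s k t x y : btm_iter s k.+1 t x y =
  (if x == y then expR (- (btm_qout s x * t)) else 0) +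
  Rintegral (@lebesgue_measure R) `[0, t]
    (fun u => expR (- (btm_qout s x * u)) *
       inflow s (fun z => btm_iter s k (t - u) z y) x).
Proof. by []. Qed.

Lemma btm_iter_ge0 s k t x y : (forall x, 0 < s x) -> 0 <= btm_iter s k t x y.
Proof.
move=> s0; elim: k t x => [//|k IH] t x; rewrite btm_iterS addr_ge0//.
  by case: ifP => // _; exact: expR_ge0.
apply: Rintegral_ge0 => u _; rewrite mulr_ge0 ?expR_ge0//.
by rewrite addr_ge0// ?mulr_ge0// ?(ltW (btm_rate_gt0 s0 _))//; case: ifP => // _;
  rewrite mulr_ge0// ltW// btm_rate_gt0.
Qed.

Lemma measurable_btm_rate d (T : measurableType d) (sig : nat -> T -> R) x :
  measurable_fun setT (sig x) -> (forall w, 0 < sig x w) ->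
  measurable_fun setT (fun w => btm_rate (sig^~ w) x).
Proof.
move=> ms s0.
(* Positivity allows the inverse to be written through [expR] and [ln], both measurable. *)
rewrite (_ : (fun w => _) = fun w => expR (- ln (2 * sig x w))).
  apply: measurableT_comp => //; apply: measurable_funN.
  by apply: measurableT_comp => //; exact: measurable_funM.
apply/funext => w; rewrite expRN lnK//.
by rewrite posrE mulr_gt0.
Qed.

(** Measurability is carried jointly in landscape and time, since each iterate integrates the
    previous one over time and Tonelli's theorem asks for a jointly measurable integrand. *)
Lemma measurable_btm_iter d (T : measurableType d) (sig : nat -> T -> R) :
  (forall x, measurable_fun setT (sig x)) -> (forall x w, 0 < sig x w) ->
  forall k x y,
  measurable_fun setT (fun p : T * R => btm_iter (sig^~ p.1) k p.2 x y).
Proof.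
move=> ms s0.
have mr x d' (T' : measurableType d') (f : T' -> T) : measurable_fun setT f ->
    measurable_fun setT (fun w => btm_rate (sig^~ (f w)) x).
  move=> mf; apply: (measurableT_comp (f := fun w => btm_rate (sig^~ w) x)) => //.
  exact: measurable_btm_rate.
have mq x d' (T' : measurableType d') (f : T' -> T) : measurable_fun setT f ->
    measurable_fun setT (fun w => btm_qout (sig^~ (f w)) x).
  by move=> mf; apply: measurable_funM => //; exact: mr.
have mexp x d' (T' : measurableType d') (f : T' -> T) (g : T' -> R) :
    measurable_fun setT f -> measurable_fun setT g ->
    measurable_fun setT (fun w => expR (- (btm_qout (sig^~ (f w)) x * g w))).
  move=> mf mg; apply: measurableT_comp => //; apply: measurable_funN.
  by apply: measurable_funM => //; exact: mq.
elim=> [|k IH] x y; first exact: measurable_cst.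
have {}IH x' d' (T' : measurableType d') (f : T' -> T) (g : T' -> R) :
    measurable_fun setT f -> measurable_fun setT g ->
    measurable_fun setT (fun w => btm_iter (sig^~ (f w)) k (g w) x' y).
  move=> mf mg.
  apply: (measurableT_comp (f := fun p : T * R => btm_iter (sig^~ p.1) k p.2 x' y)
    (g := fun w => (f w, g w))) => //.
  exact: measurable_fun_pair.
apply: measurable_funD.
  by case: (x == y); [exact: mexp|exact: measurable_cst].
(* The integrand is extended by zero so that the domain of integration no longer depends on the time
   [q.1.2]. *)
pose G (q : (T * R) * R) : R :=
  if (0 <= q.2) && (q.2 <= q.1.2) then
    expR (- (btm_qout (sig^~ q.1.1) x * q.2)) *
    inflow (sig^~ q.1.1) (fun z => btm_iter (sig^~ q.1.1) k (q.1.2 - q.2) z y) x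
  else 0.
rewrite (_ : (fun p => _) = fine \o fubini_F (@lebesgue_measure R) (EFin \o G)); last first.
  apply/funext => -[w t] /=; rewrite /Rintegral /fubini_F integral_mkcond; congr fine.
  apply: eq_integral => u _; rewrite /patch /G /= mem_setE in_itv /=.
  by case: ifP.
apply: measurableT_comp; first exact: fine_measurable.
apply: measurable_fun_fubini_tonelli_F; last first.
  move=> -[[w t] u]; rewrite /G /= lee_fin; case: ifP => // _.
  rewrite mulr_ge0 ?expR_ge0// addr_ge0//.
    by rewrite mulr_ge0 ?btm_iter_ge0// ltW// btm_rate_gt0.
  by case: ifP => // _; rewrite mulr_ge0 ?btm_iter_ge0// ltW// btm_rate_gt0.
apply/measurable_EFinP; rewrite /G.
have m1 : measurable_fun setT (fun q : (T * R) * R => q.1.1).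
  exact: (measurableT_comp measurable_fst measurable_fst).
have m2 : measurable_fun setT (fun q : (T * R) * R => q.1.2).
  exact: (measurableT_comp measurable_snd measurable_fst).
have m3 : measurable_fun setT (fun q : (T * R) * R => q.1.2 - q.2).
  by apply: measurable_funB => //; exact: measurable_snd.
apply: measurable_fun_ifT => //.
- by apply: measurable_and; apply: measurable_fun_ler => //; exact: measurable_snd.
- apply: measurable_funM; first by apply: mexp => //; exact: measurable_snd.
  apply: measurable_funD; first by apply: measurable_funM; [exact: mr|exact: IH].
  by case: (x == 0%N); [exact: measurable_cst|apply: measurable_funM; [exact: mr|exact: IH]].
Qed.

Lemma measurable_btm_iter_time s k x y : (forall x, 0 < s x) ->
  measurable_fun setT (fun t => btm_iter s k t x y).
Proof.
move=> s0.
have := @measurable_btm_iter _ R (fun x _ => s x) _ _ k x y.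
move=> /(_ (fun x => measurable_cst _) (fun x _ => s0 x)) h.
apply: (measurableT_comp (f := fun p : R * R => btm_iter (fun x => s x) k p.2 x y)
    (g := fun t => (0, t))) => //.
exact: measurable_fun_pair.
Qed.

(** * Duhamel's formula *)

Lemma bounded_integrable_itv (f : R -> R) (a b C : R) :
  measurable_fun setT f -> (forall u, a <= u <= b -> `|f u| <= C) ->
  (@lebesgue_measure R).-integrable `[a, b] (EFin \o f).
Proof.
move=> mf fC; apply: measurable_bounded_integrable => //.
- by rewrite /= lebesgue_measure_itv/=; case: ifP => //; rewrite -EFinB ltry.
- exact: measurable_funTS.
- exists C; split; first exact: num_real.
  move=> M CM u /=; rewrite in_itv /= => /fC /le_trans; apply; exact: ltW.
Qed.

Lemma is_derive_affine (a b u : R) : is_derive u 1 (fun v : R => a * v + b) a.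
Proof.
have h : is_derive u 1 (fun v : R => a * v + b) _ :=
  is_deriveD (is_deriveM (is_derive_cst a u 1) (is_derive_id u 1))
    (is_derive_cst b u 1).
by apply: is_derive_eq h _; rewrite /GRing.scale /=; ring.
Qed.

Lemma continuous_duhamel (q t : R) (f f' : R -> R) :
  continuous f -> continuous f' ->
  continuous (fun u => expR (- (q * u)) * (f' (t - u) + q * f (t - u))).
Proof.
move=> cf cf' v.
have c1 : {for v, continuous (fun u => t - u)}.
  by apply: cvgB; [exact: cvg_cst|exact: cvg_id].
apply: cvgM.
  apply: (continuous_comp (f := fun u => - (q * u)) (g := expR)).
    by apply: cvgN; apply: cvgM; [exact: cvg_cst|exact: cvg_id].
  exact: continuous_expR.
apply: cvgD; first by apply: (continuous_comp c1); exact: cf'.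
by apply: cvgM; [exact: cvg_cst|apply: (continuous_comp c1); exact: cf].
Qed.

(** The fundamental theorem of calculus for [- expR (- (q * u)) * f (t - u)]. It puts [f] in the
    form of the backward equation with source [f' + q f], so comparing with the iterates amounts to
    comparing sources. *)
Lemma duhamel (q t : R) (f f' : R -> R) : 0 <= t ->
  (forall v : R, is_derive v 1 f (f' v)) -> continuous f' ->
  f t = f 0 * expR (- (q * t)) +
    Rintegral (@lebesgue_measure R) `[0, t]
      (fun u => expR (- (q * u)) * (f' (t - u) + q * f (t - u))).
Proof.
rewrite le_eqVlt => /predU1P[<-|t0] df cf'.
  by rewrite set_itv1 Rintegral_set1 mulr0 oppr0 expR0 mulr1 addr0.
pose F u := - (expR (- (q * u)) * f (t - u)).
have dF (u : R) : is_derive u 1 F (expR (- (q * u)) * (f' (t - u) + q * f (t - u))).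
  have d1 : is_derive u 1 (fun u => - (q * u)) (- q).
    rewrite (_ : (fun u => _) = (fun u => - q * u + 0)).
      exact: is_derive_affine.
    by apply/funext => v; ring.
  have d2 : is_derive u 1 (fun u => expR (- (q * u))) (expR (- (q * u)) * - q).
    exact: (is_derive1_comp (f := expR) (g := fun u => - (q * u))).
  have d3 : is_derive u 1 (fun u => t - u) (-1).
    rewrite (_ : (fun u => _) = (fun u => -1 * u + t)).
      exact: is_derive_affine.
    by apply/funext => v; ring.
  have d4 : is_derive u 1 (fun u => f (t - u)) (f' (t - u) * -1).
    exact: (is_derive1_comp (f := f) (g := fun u => t - u)).
  have h : is_derive u 1 F _ := is_deriveN (is_deriveM d2 d4).
  apply: is_derive_eq h _.
  by rewrite /GRing.scale /=; ring.
have cf : continuous f.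
  by move=> v; apply/differentiable_continuous/derivable1_diffP; case: (df v).
have cF : continuous F.
  by move=> v; apply/differentiable_continuous/derivable1_diffP; case: (dF v).
rewrite /Rintegral (@continuous_FTC2 _ _ F 0 t)//.
- rewrite /F /= subrr subr0 mulr0 oppr0 expR0; ring.
- by apply: continuous_subspaceT; exact: continuous_duhamel.
- split=> [v _| |]; first by case: (dF v).
  + by apply: cvg_at_right_filter; exact: cF.
  + by apply: cvg_at_left_filter; exact: cF.
- by move=> v _; rewrite derive1E; case: (dF v).
Qed.

End Iterates.

(** * Uniformization *)

Section TransitionBounds.
Variables (R : realType) (s : nat -> R).
Hypothesis s_gt0 : forall x, 0 < s x.

(** * Bounds and monotone convergence of the Picard iterates *)

Lemma measurable_inflow_time k t x y : measurable_fun setT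
  (fun u : R => expR (- (btm_qout s x * u)) *
     inflow s (fun z => btm_iter s k (t - u) z y) x).
Proof.
have mt x' : measurable_fun setT (fun u : R => btm_iter s k (t - u) x' y).
  apply: (measurableT_comp (f := fun t => btm_iter s k t x' y)).
    exact: measurable_btm_iter_time.
  exact: measurable_funB.
apply: measurable_funM.
  by apply: measurableT_comp => //; apply: measurable_funN; exact: measurable_funM.
apply: measurable_funD; first exact: measurable_funM.
by case: (x == 0%N); [exact: measurable_cst|exact: measurable_funM].
Qed.

Lemma duhamel1 q t : 0 <= t -> 1 = expR (- (q * t)) +
  Rintegral (@lebesgue_measure R) `[0, t] (fun u => expR (- (q * u)) * q).
Proof.
move=> t0; have := @duhamel R q t (cst 1) (cst 0) t0.
move=> /(_ (fun v => is_derive_cst _ _ _) (fun v => cvg_cst _)).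
rewrite mul1r /= => {1}->; congr (_ + _).
by apply: eq_Rintegral => u _; rewrite add0r mulr1.
Qed.

Lemma expRN_le1 q u : 0 <= q -> 0 <= u -> expR (- (q * u)) <= 1 :> R.
Proof. by move=> q0 u0; rewrite -expR0 ler_expR oppr_le0 mulr_ge0. Qed.

Lemma integrable_inflow k t x y :
  (forall u z, 0 <= u -> btm_iter s k u z y <= 1) ->
  (@lebesgue_measure R).-integrable `[0, t] (EFin \o
    (fun u => expR (- (btm_qout s x * u)) *
       inflow s (fun z => btm_iter s k (t - u) z y) x)).
Proof.
move=> p1; apply: (@bounded_integrable_itv _ _ _ _ (btm_qout s x)).
  exact: measurable_inflow_time.
move=> u /andP[u0 ut]; have q0 := ltW (btm_qout_gt0 s_gt0 x).
have i0 : 0 <= inflow s (fun z => btm_iter s k (t - u) z y) x.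
  rewrite -[leLHS](_ : inflow s (fun=> 0) x = 0); last by rewrite inflow_cst mulr0.
  by apply: inflow_le => //; exact: btm_iter_ge0.
rewrite ger0_norm ?mulr_ge0 ?expR_ge0//.
rewrite -[leRHS]mul1r ler_pM ?expR_ge0 ?expRN_le1//.
rewrite -[leRHS]mulr1 -inflow_cst inflow_le//; apply: p1; rewrite subr_ge0//.
Qed.

(** The constant 1 solves the same integral equation with a full initial term ([duhamel1]), and the
    equation is monotone. *)
Lemma btm_iter_le1 k t x y : 0 <= t -> btm_iter s k t x y <= 1.
Proof.
elim: k t x => [|k IH] t x t0; first exact: ler01.
have q0 := ltW (btm_qout_gt0 s_gt0 x).
rewrite btm_iterS [leRHS](duhamel1 (btm_qout s x) t0) lerD//.
  by case: ifP => // _; exact: expR_ge0.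
apply: le_Rintegral => //.
- by apply: integrable_inflow => u z u0; exact: IH.
- apply: (@bounded_integrable_itv _ _ _ _ (btm_qout s x)).
    apply: measurable_funM => //.
    by apply: measurableT_comp => //; apply: measurable_funN; exact: measurable_funM.
  move=> u /andP[u0 _]; rewrite ger0_norm; last by rewrite mulr_ge0// expR_ge0.
  by rewrite -[leRHS]mul1r ler_wpM2r// expRN_le1.
- move=> u /=; rewrite in_itv /= => /andP[u0 ut].
  rewrite ler_wpM2l ?expR_ge0//.
  by rewrite -[leRHS]mulr1 -inflow_cst inflow_le//; apply: IH; rewrite subr_ge0.
Qed.

Lemma btm_iter_leS k t x y : 0 <= t -> btm_iter s k t x y <= btm_iter s k.+1 t x y.
Proof.
elim: k t x => [|k IH] t x t0; first exact: btm_iter_ge0.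
rewrite [leRHS]btm_iterS btm_iterS lerD2l; apply: le_Rintegral => //.
- by apply: integrable_inflow => u z u0; exact: btm_iter_le1.
- by apply: integrable_inflow => u z u0; exact: btm_iter_le1.
- move=> u /=; rewrite in_itv /= => /andP[u0 ut].
  rewrite ler_wpM2l ?expR_ge0// inflow_le//; apply: IH; rewrite subr_ge0//.
Qed.

(** Monotone and bounded iterates: the [limn] in [btm_trans] is a genuine limit. *)
Lemma cvg_btm_trans t x y : 0 <= t ->
  (fun k => btm_iter s k t x y) @ \oo --> btm_trans s t x y.
Proof.
move=> t0; apply: nondecreasing_is_cvgn.
  by apply/nondecreasing_seqP => k; exact: btm_iter_leS.
by exists 1 => _ [k _ <-]; exact: btm_iter_le1.
Qed.

Lemma btm_iter_le_trans k t x y : 0 <= t -> btm_iter s k t x y <= btm_trans s t x y.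
Proof.
move=> t0; apply: (@nondecreasing_cvgn_le _ (fun k => btm_iter s k t x y)).
  by apply/nondecreasing_seqP => m; exact: btm_iter_leS.
by apply/cvg_ex; exists (btm_trans s t x y); exact: cvg_btm_trans.
Qed.

Lemma btm_trans_le1 t x y : 0 <= t -> btm_trans s t x y <= 1.
Proof.
move=> t0; apply: limr_le.
  by apply/cvg_ex; exists (btm_trans s t x y); exact: cvg_btm_trans.
by apply: nearW => k; exact: btm_iter_le1.
Qed.

(** * Comparison of the uniformized chain with the iterates *)

Section Uniformization.
Variables (n : nat) (Lam : R) (z : nat).
Hypothesis Lam_gt0 : 0 < Lam.
Hypothesis Lam_ge : forall x, (x < n)%N -> (s x)^-1 <= Lam.
Hypothesis zn : (z < n)%N.

Definition poisson_weight m (v : R) : R :=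
  expR (- (Lam * v)) * (Lam * v) ^+ m / m`!%:R.

Let a := killed_at s n Lam z.

(* The chance that the chain killed outside [0, n), run as a discrete chain at
   the times of a Poisson process of rate [Lam], sits at [z] at time [t] after
   fewer than [N] Poisson times. *)
Definition uniformized N t x : R := \sum_(m < N) poisson_weight m t * a m x.

(** The time derivative of [uniformized N.+1]: the Poisson weights satisfy
    [w_m' = Lam * (w_(m-1) - w_m)], so the gain sum has one term fewer than the loss sum. *)
Definition duniformized N t x : R :=
  Lam * (\sum_(m < N) poisson_weight m t * a m.+1 x -
         \sum_(m < N.+1) poisson_weight m t * a m x).

Lemma is_derive_poisson0 (v : R) :
  is_derive v 1 (poisson_weight 0) (- Lam * poisson_weight 0 v).
Proof.
rewrite /poisson_weight (_ : (fun _ => _) = (fun v => expR (- Lam * v + 0))).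
  have h : is_derive v 1 (fun v => expR (- Lam * v + 0)) _ :=
    is_derive1_comp (is_derive_expR _) (is_derive_affine (- Lam) 0 v).
  apply: is_derive_eq h _.
  by rewrite expr0 fact0 addr0 mulNr; field.
by apply/funext => u; rewrite expr0 fact0 addr0 mulNr; field.
Qed.

Lemma is_derive_poissonS m (v : R) :
  is_derive v 1 (poisson_weight m.+1)
    (Lam * (poisson_weight m v - poisson_weight m.+1 v)).
Proof.
have d1 : is_derive v 1 (fun v => expR (- Lam * v + 0)) _ :=
  is_derive1_comp (is_derive_expR _) (is_derive_affine (- Lam) 0 v).
have d2 : is_derive v 1 (fun v : R => (Lam * v + 0) ^+ m.+1)
    ((m.+1%:R * (Lam * v + 0) ^+ m) *: Lam).
  have -> : (fun v : R => (Lam * v + 0) ^+ m.+1) = (fun v : R => Lam * v + 0) ^+ m.+1.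
    by rewrite exprfctE.
  exact: (is_deriveX m.+1 (is_derive_affine Lam 0 v)).
have d3 : is_derive v 1
    (fun v : R => expR (- Lam * v + 0) * (Lam * v + 0) ^+ m.+1 * (m.+1)`!%:R^-1) _ :=
  is_deriveM (is_deriveM d1 d2) (is_derive_cst ((m.+1)`!%:R^-1 : R) v 1).
rewrite (_ : poisson_weight m.+1 =
  (fun v : R => expR (- Lam * v + 0) * (Lam * v + 0) ^+ m.+1 * (m.+1)`!%:R^-1)).
  apply: is_derive_eq d3 _; rewrite /poisson_weight /GRing.scale /GRing.mul /=.
  rewrite -!/(GRing.mul _ _) !addr0 mulNr factS natrM exprS.
  have m0 : (m`!)%:R != 0 :> R by rewrite pnatr_eq0 -lt0n fact_gt0.
  have m1 : (m.+1)%:R != 0 :> R by rewrite pnatr_eq0.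
  by move: m1; rewrite -natr1 => m1; field; rewrite m0 m1.
by apply/funext => u; rewrite /poisson_weight !addr0 mulNr.
Qed.

Lemma is_derive_uniformized N x (v : R) :
  is_derive v 1 (uniformized N.+1 ^~ x) (duniformized N v x).
Proof.
elim: N => [|N IH].
  rewrite (_ : uniformized 1 ^~ x = a 0 x \*: poisson_weight 0).
    apply: is_derive_eq; first by apply: is_deriveZ; exact: is_derive_poisson0.
    by rewrite /duniformized big_ord0 big_ord1 /GRing.scale /=; ring.
  by apply/funext => u; rewrite /uniformized big_ord1 mulrC.
rewrite (_ : uniformized N.+2 ^~ x =
    uniformized N.+1 ^~ x + (a N.+1 x \*: poisson_weight N.+1)).
  have h := is_deriveD IH (is_deriveZ (a N.+1 x) (is_derive_poissonS N v)).
  apply: is_derive_eq h _.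
  rewrite /duniformized [in RHS]big_ord_recr [X in _ = _ * (_ - X)]big_ord_recr.
  by rewrite /GRing.scale /=; ring.
apply/funext => u; rewrite /uniformized big_ord_recr /=.
by congr (_ + _); rewrite mulrC.
Qed.

Lemma continuous_poisson_sum N (b : nat -> R) :
  continuous (fun v => \sum_(m < N) poisson_weight m v * b m).
Proof.
elim: N => [|N IH] v.
  rewrite (_ : (fun v => _) = cst 0); first exact: cvg_cst.
  by apply/funext => u; rewrite big_ord0.
rewrite (_ : (fun v => _) =
    (fun v => \sum_(m < N) poisson_weight m v * b m + poisson_weight N v * b N)).
  apply: cvgD; first exact: IH.
  apply: cvgM; last exact: cvg_cst.
  apply/differentiable_continuous/derivable1_diffP.
  by case: (N) => [|k];
    [case: (is_derive_poisson0 v)|case: (is_derive_poissonS k v)].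
by apply/funext => u; rewrite big_ord_recr.
Qed.

Lemma continuous_uniformized N x : continuous (uniformized N ^~ x).
Proof. exact: (@continuous_poisson_sum N (a ^~ x)). Qed.

Lemma poisson_weight_ge0 m v : 0 <= v -> 0 <= poisson_weight m v.
Proof.
by move=> v0; rewrite !mulr_ge0 ?invr_ge0 ?expR_ge0// exprn_ge0 ?mulr_ge0// ltW.
Qed.

(** The truncated sum solves the backward equation up to its last term [m = N], which contributes a
    loss but no gain. *)
Lemma duniformizedE N v x : (x < n)%N -> duniformized N v x =
  inflow s (uniformized N v) x - btm_qout s x * uniformized N v x -
  Lam * poisson_weight N v * a N x.
Proof.
move=> xn; rewrite /duniformized big_ord_recr /= opprD addrA -sumrB.
rewrite (eq_bigr (fun m : 'I_N => poisson_weight m v * (Lam^-1 *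
    (inflow s (a m) x - btm_qout s x * a m x)))); last first.
  by move=> m _ /=; rewrite kstepE//; field; rewrite gt_eqF.
rewrite mulrBr mulrA; congr (_ - _).
rewrite mulr_sumr /uniformized.
have -> : inflow s (fun y => \sum_(m < N) poisson_weight m v * a m y) x =
    \sum_(m < N) poisson_weight m v * inflow s (a m) x.
  rewrite /inflow; case: (x == 0%N).
    by rewrite addr0 mulr_sumr; apply: eq_bigr => m _; ring.
  by rewrite !mulr_sumr -big_split; apply: eq_bigr => m _ /=; ring.
rewrite mulr_sumr -sumrB; apply: eq_bigr => m _.
by field; rewrite gt_eqF.
Qed.

Lemma uniformized_out N v x : (n <= x)%N -> uniformized N v x = 0.
Proof.
move=> nx; rewrite /uniformized big1// => m _.
by rewrite /a killed_at_out ?mulr0.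
Qed.

Lemma uniformized0 N x : uniformized N.+1 0 x = (x == z)%:R.
Proof.
rewrite /uniformized big_ord_recl /poisson_weight mulr0 oppr0 expR0 expr0 fact0.
rewrite !mul1r invr1 mul1r big1 ?addr0// => i _.
by rewrite expr0n mulr0 !mul0r.
Qed.

(** Every jump happens at a Poisson time, so fewer than [N] Poisson times means fewer than [N]
    jumps. Formally, Duhamel with [q = btm_qout s x] leaves the source [inflow (uniformized N)] plus
    [(btm_qout s x - Lam)] times a nonnegative term, and [btm_qout s x <= Lam]. *)
Lemma uniformized_le_iter N t x : 0 <= t -> uniformized N t x <= btm_iter s N t x z.
Proof.
elim: N t x => [|N IH] t x t0; first by rewrite /uniformized big_ord0.
have [nx|xn] := leqP n x; first by rewrite uniformized_out// btm_iter_ge0.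
have q0 := btm_qout_gt0 s_gt0 x.
have cd : continuous (duniformized N ^~ x).
  have E : duniformized N ^~ x = (fun v => Lam * ((\sum_(m < N) poisson_weight m v * a m.+1 x) -
     uniformized N.+1 v x)) by [].
  move=> v; rewrite E; apply: cvgM; first exact: cvg_cst.
  apply: cvgB; last exact: continuous_uniformized.
  exact: (@continuous_poisson_sum N (fun m => a m.+1 x)).
rewrite (duhamel (btm_qout s x) t0 (is_derive_uniformized N x) cd).
rewrite uniformized0 btm_iterS lerD//.
  by case: eqP => _; rewrite ?mul1r ?mul0r.
apply: le_Rintegral => //.
- apply: continuous_compact_integrable; first exact: segment_compact.
  apply: continuous_subspaceT.
  exact: (continuous_duhamel (@continuous_uniformized N.+1 x) cd).
- by apply: integrable_inflow => u y u0; exact: btm_iter_le1.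
- move=> u /=; rewrite in_itv /= => /andP[u0 ut].
  have tu : 0 <= t - u by rewrite subr_ge0.
  rewrite ler_wpM2l ?expR_ge0//.
  apply: (@le_trans _ _ (inflow s (uniformized N (t - u)) x)); last first.
    by apply: inflow_le => //; exact: IH.
  have -> : uniformized N.+1 (t - u) x =
      uniformized N (t - u) x + poisson_weight N (t - u) * a N x.
    by rewrite /uniformized big_ord_recr.
  rewrite duniformizedE//.
  have : 0 <= poisson_weight N (t - u) * a N x.
    by rewrite mulr_ge0 ?poisson_weight_ge0 ?(killed_at_ge0 s_gt0 Lam_gt0 Lam_ge).
  have : btm_qout s x <= Lam := le_trans (btm_qout_le s_gt0 x) (Lam_ge xn).
  rewrite -[Lam * _ * _]mulrA.
  move: (poisson_weight N (t - u) * a N x) (inflow _ _ _) (uniformized _ _ _) => A B C.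
  by nra.
Qed.

End Uniformization.
End TransitionBounds.

(** * The quenched lower bound *)

Section PoissonSums.
Variables (R : realType) (Lam t : R).
Hypotheses (Lam_gt0 : 0 < Lam) (t_gt0 : 0 < t).
Let mu := Lam * t.
Let mu_gt0 : 0 < mu. Proof. exact: mulr_gt0. Qed.
Let pw m := poisson_weight Lam m t.

(** This shift reduces the means of [m] and of [1 / (m + 1)] to the total mass, with factors [mu]
    and [1 / mu]. *)
Lemma poisson_weightS m : m.+1%:R * pw m.+1 = mu * pw m.
Proof.
rewrite /pw /poisson_weight -/mu factS natrM exprS.
have m0 : (m`!)%:R != 0 :> R by rewrite pnatr_eq0 -lt0n fact_gt0.
have m1 : (m.+1)%:R != 0 :> R by rewrite pnatr_eq0.
by move: m1; rewrite -natr1 => m1; field; rewrite m0 m1.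
Qed.

Let pw_ge0 m : 0 <= pw m.
Proof. exact: (poisson_weight_ge0 Lam_gt0 _ (ltW t_gt0)). Qed.

Lemma cvg_poisson_sum : (fun N => \sum_(m < N) pw m) @ \oo --> (1 : R).
Proof.
rewrite (_ : (fun N => _) = (fun N => expR (- mu) * series (exp_coeff mu) N)).
  rewrite -[X in _ --> X](expRxMexpNx_1 mu) mulrC.
  by apply: cvgM; [exact: cvg_cst|exact: is_cvg_series_exp_coeff].
apply/funext => N; rewrite /series /= big_mkord mulr_sumr.
by apply: eq_bigr => m _; rewrite /pw /poisson_weight -/mu mulrA.
Qed.

Lemma poisson_sum_le1 N : \sum_(m < N) pw m <= 1.
Proof.
have nd : nondecreasing_seq (fun N => \sum_(m < N) pw m).
  by apply/nondecreasing_seqP => k; rewrite big_ord_recr /= lerDl.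
rewrite -(cvg_lim (@Rhausdorff R) cvg_poisson_sum).
apply: (nondecreasing_cvgn_le nd).
by apply/cvg_ex; exists 1; exact: cvg_poisson_sum.
Qed.

Lemma poisson_mean_le N : \sum_(m < N) pw m * m%:R <= mu.
Proof.
case: N => [|N]; first by rewrite big_ord0 ltW.
rewrite big_ord_recl mulr0 add0r.
rewrite (eq_bigr (fun m : 'I_N => mu * pw m)) => [|m _]; last first.
  by rewrite mulrC poisson_weightS.
by rewrite -mulr_sumr -[leRHS]mulr1 ler_wpM2l ?poisson_sum_le1// ltW.
Qed.

Lemma poisson_inv_mean_le N : \sum_(m < N) pw m / m.+1%:R <= mu^-1.
Proof.
rewrite (eq_bigr (fun m : 'I_N => mu^-1 * pw m.+1)) => [|m _]; last first.
  have := poisson_weightS m; move/(congr1 (fun x => mu^-1 * x / m.+1%:R)).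
  rewrite mulKf ?gt_eqF// => <-.
  by rewrite [m.+1%:R * _]mulrC mulrA mulfK ?pnatr_eq0.
rewrite -mulr_sumr -[leRHS]mulr1 ler_wpM2l ?invr_ge0 ?(ltW mu_gt0)//.
by apply: le_trans (poisson_sum_le1 N.+1); rewrite big_ord_recl lerDr.
Qed.

End PoissonSums.

(** [killed_at_lb] from site 0, averaged over a Poisson number of steps of mean [Lam * t]; [Lam]
    cancels from the resulting bound. *)
Theorem btm_prob_lb (R : realType) (s : nat -> R) (n z : nat) (t : R) :
  (forall x, 0 < s x) -> (z < n)%N -> 0 < t ->
  1 - trap_error s n z - t / (2 * s z * (n - z)%:R)
    - 2 * (z%:R * \sum_(j < z) s j) / t <= btm_prob s t z.
Proof.
move=> s0 zn t0.
(* Any common bound of the [1 / s x] would serve, and the sum is one. *)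
pose Lam := \sum_(x < n) (s x)^-1.
have Lam_ge x : (x < n)%N -> (s x)^-1 <= Lam.
  move=> xn; rewrite /Lam (bigD1 (Ordinal xn))//= lerDl sumr_ge0// => i _.
  by rewrite invr_ge0 ltW.
have Lam0 : 0 < Lam by apply: lt_le_trans (Lam_ge _ zn); rewrite invr_gt0.
have mu0 : 0 < Lam * t by rewrite mulr_gt0.
have B0 : 0 <= trap_error s n z.
  by rewrite mulr_ge0 ?invr_ge0 ?sumr_ge0// => *; rewrite ltW.
set c := exit_rate s n Lam z.
have c0 : 0 < c by rewrite invr_gt0 !mulr_gt0// ltr0n subn_gt0.
have h0 := hit_mean_ge0 s0 Lam0 z 0.
set h := hit_mean s Lam z 0 in h0.
pose S N := \sum_(m < N) poisson_weight Lam m t.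
pose S' N := \sum_(m < N) poisson_weight Lam m t * m%:R.
pose S'' N := \sum_(m < N) poisson_weight Lam m t / m.+1%:R.
(* The right side is independent of [N], so letting [N] grow replaces the truncated Poisson mass
   [S N] by 1. *)
have key N : S N <= btm_prob s t z + trap_error s n z + c * (Lam * t) + h / (Lam * t).
  have H : S N * (1 - trap_error s n z) -
c * S' N - h * S'' N <= btm_prob s t z.
    apply: le_trans (btm_iter_le_trans s0 N 0 z (ltW t0)).
    apply: le_trans (uniformized_le_iter s0 Lam0 Lam_ge zn N 0 (ltW t0)).
    rewrite /S /S' /S'' mulr_suml !mulr_sumr -!sumrB ler_sum// => m _.
    have p0 := poisson_weight_ge0 Lam0 m (ltW t0).
    apply: le_trans (ler_wpM2l p0 (killed_at_lb s0 Lam0 Lam_ge zn m (leq0n z))).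
    by rewrite -/c -/h le_eqVlt; apply/orP; left; apply/eqP; ring.
  have S1 : S N <= 1 := poisson_sum_le1 Lam0 t0 N.
  have := ler_wpM2l (ltW c0) (poisson_mean_le Lam0 t0 N).
  have := ler_wpM2l h0 (poisson_inv_mean_le Lam0 t0 N).
  have : S N * trap_error s n z <= trap_error s n z by rewrite ler_piMl.
  move: H; rewrite mulrBr mulr1.
  rewrite -/(S' N) -/(S'' N).
  move: (S N * _) (c * S' N) (h * S'' N) (c * _) (h / _) => A B C D E.
  by lra.
have {}key : 1 <= btm_prob s t z + trap_error s n z + c * (Lam * t) + h / (Lam * t).
  apply: (cvgr_to_le (cvg_poisson_sum Lam t)).
  by apply: nearW => N; exact: key.
have -> : t / (2 * s z * (n - z)%:R) = c * (Lam * t).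
  by rewrite /c /exit_rate; field; rewrite !gt_eqF ?ltr0n ?subn_gt0.
have : h / (Lam * t) <= 2 * (z%:R * \sum_(j < z) s j) / t.
  rewrite ler_pdivrMr// (_ : _ / t * _ = 2 * Lam * (z%:R * \sum_(j < z) s j)).
    exact: hit_mean0_le.
  by field; rewrite gt_eqF.
by move: key; move: (h / _) (c * _) (_ / t) => A B C; lra.
Qed.

(** * Typical landscapes *)

Lemma cvg0_contraction (R : realType) (u r : nat -> R) :
  (forall k, 0 <= u k) -> r @ \oo --> (1 : R) ->
  (forall k, u k.+1 = u k * r k / 2 + (r k - 1)) -> u @ \oo --> (0 : R).
Proof.
move=> u0 r1 ur; apply/cvgrPdist_le => e e0.
(* Then the slope [r k / 2] is at most 3/4 and the errors add up to at most
   [(e / 8) / (1 - 3 / 4) = e / 2]. *)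
have : \forall k \near \oo, `|1 - r k| <= Num.min (1 / 2) (e / 8).
  by move/cvgrPdist_le : r1; apply; rewrite lt_min !divr_gt0.
move=> -[k0 _ hr].
have step j : u (k0 + j)%N <= (3 / 4) ^+ j * u k0 + e / 2.
  elim: j => [|j IH]; first by rewrite addn0 expr0 mul1r lerDl divr_ge0// ltW.
  have := hr (k0 + j)%N (leq_addr _ _); rewrite /= le_min !ler_norml.
  move=> /andP[/andP[h1 h2] /andP[h3 h4]].
  rewrite addnS ur exprS -[_ * _ ^+ j * _]mulrA; have := u0 (k0 + j)%N.
  move: ((3 / 4) ^+ j * u k0) (u (k0 + j)%N) (r (k0 + j)%N) IH h1 h2 h3 h4.
  move=> A U r' IH h1 h2 h3 h4 U0.
  have : U * r' <= U * (3 / 2) by rewrite ler_wpM2l//; lra.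
  by lra.
have : \forall j \near \oo, (3 / 4) ^+ j * u k0 <= e / 2.
  have /cvgrPdist_le : (fun j => (3 / 4) ^+ j * u k0) @ \oo --> (0 : R).
    rewrite -[X in _ --> X](mul0r (u k0)); apply: cvgM; last exact: cvg_cst.
    by apply: cvg_expr; rewrite ger0_norm; lra.
  move=> /(_ (e / 2)); rewrite divr_gt0// => /(_ isT).
  by apply: filterS => j; rewrite sub0r normrN => /(le_trans (ler_norm _)).
move=> -[j0 _ hj].
exists (k0 + j0)%N => // k /= kk; rewrite sub0r normrN ger0_norm//.
have kE : k = (k0 + (k - k0))%N by lia.
rewrite kE; apply: le_trans (step _) _.
have := hj (k - k0)%N; rewrite /= => /(_ _); rewrite leq_subRL; last by lia.
by move=> /(_ kk); lra.
Qed.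

Section Tail.
Variables (d : measure_display) (Omega : measurableType d) (R : realType).
Variables (P : probability Omega R) (sigma : nat -> Omega -> R).
Hypothesis sigma_meas : forall x, measurable_fun setT (sigma x).
Hypothesis sigma_pos : forall x w, 0 < sigma x w.
Hypothesis sigma_indep : iid_indep P sigma.
Hypothesis sigma_ident : ident_distr P sigma.
Hypothesis tail_pos : forall u : R, (0 < P [set w | (u < sigma 0%N w)%R])%E.
Hypothesis L_sv : slowly_varying (tailL P sigma).

Definition tail (u : R) : R := fine (P [set w | u < sigma 0 w]).

Lemma measurable_exceed x u : measurable [set w | u < sigma x w].
Proof.
have := sigma_meas x measurableT (measurable_itv `]u, +oo[).
by rewrite setTI; congr measurable; apply/seteqP; split => w /=;
  rewrite in_itv /= andbT.
Qed.

Lemma measurable_not_exceed x u : measurable [set w | sigma x w <= u].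
Proof.
rewrite (_ : [set w | _] = ~` [set w | u < sigma x w]).
  exact/measurableC/measurable_exceed.
by apply/seteqP; split => w /=; rewrite ltNge; [move=> ->|move/negP; rewrite negbK].
Qed.

Lemma P_exceed x u : P [set w | u < sigma x w] = (tail u)%:E.
Proof.
rewrite /tail fineK ?fin_num_measure//; last exact: measurable_exceed.
have := sigma_ident x (measurable_itv `]u, +oo[).
have E y : sigma y @^-1` `]u, +oo[%classic = [set w | u < sigma y w].
  by apply/seteqP; split => w /=; rewrite in_itv /= andbT.
by rewrite !E.
Qed.

Lemma tail_gt0 u : 0 < tail u.
Proof. by rewrite -lte_fin -(P_exceed 0); exact: tail_pos. Qed.

Lemma tail_le1 u : tail u <= 1.
Proof. by rewrite -lee_fin -(P_exceed 0); apply: probability_le1; exact: measurable_exceed. Qed.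

Lemma tail_le u v : u <= v -> tail v <= tail u.
Proof.
move=> uv; rewrite -lee_fin -!(P_exceed 0); apply: le_measure;
  rewrite ?inE; try exact: measurable_exceed.
by move=> w /=; exact: le_lt_trans.
Qed.

Lemma P_not_exceed x u : P [set w | sigma x w <= u] = (1 - tail u)%:E.
Proof.
rewrite (_ : [set w | _] = ~` [set w | u < sigma x w]).
  by rewrite probability_setC ?P_exceed//; exact: measurable_exceed.
by apply/seteqP; split => w /=; rewrite ltNge; [move=> ->|move/negP; rewrite negbK].
Qed.

Lemma P_between x u v : u <= v ->
  P [set w | u < sigma x w <= v] = (tail u - tail v)%:E.
Proof.
move=> uv.
rewrite (_ : [set w | _] = [set w | u < sigma x w] `\` [set w | v < sigma x w]).
  rewrite (measureD (measurable_exceed x u) (measurable_exceed x v)).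
    rewrite setIidr; last by move=> w /=; exact: le_lt_trans.
    by rewrite EFinB; congr (_ - _)%E; exact: P_exceed.
  by apply: (le_lt_trans (probability_le1 P (measurable_exceed x u))); rewrite ltry.
apply/seteqP; split => w /=; rewrite [v < _]ltNge.
  by move=> /andP[-> ->].
by move=> [-> /negP]; rewrite negbK.
Qed.

Lemma tail_ratio (V : R) : 0 < V ->
  (fun k => tail (2 ^+ k) / tail (2 ^+ k * V)) @ \oo --> (1 : R).
Proof.
move=> V0.
have cvy : (fun k => (2 : R) ^+ k) @ \oo --> +oo.
  apply/cvgryPge => A; near=> k.
  have : A <= k%:R by near: k; exact: nbhs_infty_ger.
  by move/le_trans; apply; rewrite -natrX ler_nat ltnW// ltn_expl.
have := cvg_comp _ _ cvy (L_sv V0).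
rewrite /tailL; apply: cvg_trans; apply: near_eq_cvg; apply: nearW => k /=.
by rewrite -!/(tail _) invrK mulrC.
Unshelve. all: by end_near. Qed.

(** Continuity from above: the nested events have empty intersection because [sigma 0] is finite. *)
Lemma tail_cvg0 : (fun k => tail (2 ^+ k)) @ \oo --> (0 : R).
Proof.
have h : P (\bigcap_k [set w | 2 ^+ k < sigma 0 w]) = 0%E.
  rewrite (_ : \bigcap_k _ = set0) ?measure0//.
  rewrite -subset0 => w /= hw.
  have [k hk] : exists k : nat, sigma 0 w <= k%:R.
    by exists (Num.bound (sigma 0 w)); rewrite ltW// archi_boundP// ltW.
  have := hw k I; apply/negP; rewrite -leNgt (le_trans hk)//.
  by rewrite -natrX ler_nat ltnW// ltn_expl.
rewrite (_ : 0 = fine (P (\bigcap_k [set w | 2 ^+ k < sigma 0 w]))); last by rewrite h.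
apply: fine_cvg; rewrite fineK ?h//.
rewrite -[X in _ --> X]h; apply: nonincreasing_cvg_mu.
- by apply: (le_lt_trans (probability_le1 P (measurable_exceed 0 _))); rewrite ltry.
- by move=> k; exact: measurable_exceed.
- by apply: bigcapT_measurable => k; exact: measurable_exceed.
- move=> k k' kk'; apply/subsetPset => w /=; apply: le_lt_trans.
  by rewrite ler_eXn2l// ltr1n.
Qed.

(** * Independence: no exceedance, and two exceedances *)

Lemma P_none_exceed M u :
  P [set w | forall x, (x < M)%N -> sigma x w <= u] = ((1 - tail u) ^+ M)%:E.
Proof.
have := sigma_indep (iota_uniq 0 M) (fun i _ => measurable_itv `]-oo, u]).
rewrite (_ : \bigcap_(i in _) _ = [set w | forall x, (x < M)%N -> sigma x w <= u]); last first.
  apply/seteqP; split => w /= hw x.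
    by move=> xM; have := hw x; rewrite /= mem_iota add0n leq0n xM in_itv /=; apply.
  by rewrite /= mem_iota add0n leq0n /= => xM; rewrite in_itv /= hw.
move=> ->; rewrite (eq_bigr (fun=> (1 - tail u)%:E)); last first.
  move=> i _; rewrite -(P_not_exceed i); congr (P _).
by rewrite prodEFin big_const_seq count_predT size_iota iter_mulr_1.
Qed.

Lemma P_two_exceed x y u : x != y ->
  P [set w | u < sigma x w /\ u < sigma y w] = (tail u ^+ 2)%:E.
Proof.
move=> xy; have U : uniq [:: x; y] by rewrite /= inE xy.
have := sigma_indep U (fun i _ => measurable_itv `]u, +oo[).
rewrite (_ : \bigcap_(i in _) _ = [set w | u < sigma x w /\ u < sigma y w]); last first.
  apply/seteqP; split => w /=.
    move=> hw; split.
      by have := hw x; rewrite /= mem_head in_itv /= andbT; apply.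
    by have := hw y; rewrite /= in_cons mem_head orbT in_itv /= andbT; apply.
  by move=> [h1 h2] i /=; rewrite in_cons mem_seq1 in_itv /= andbT => /orP[]/eqP ->.
move=> ->; rewrite big_cons big_seq1 expr2 EFinM; congr (_ * _)%E.
  rewrite -(P_exceed x); congr (P _).
  by apply/seteqP; split => w /=; rewrite in_itv /= andbT.
rewrite -(P_exceed y); congr (P _).
by apply/seteqP; split => w /=; rewrite in_itv /= andbT.
Qed.

(* A sum over dyadic layers that dominates [sigma x] on [sigma x <= 2 ^+ k]; its
   mean involves only the tail at powers of two. *)
Definition dyadic_layers k x (w : Omega) : R :=
  1 + \sum_(j < k) 2 ^+ j.+1 * \1_[set w | 2 ^+ j < sigma x w <= 2 ^+ j.+1] w.

Definition dyadic_mean k : R :=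
  1 + \sum_(j < k) 2 ^+ j.+1 * (tail (2 ^+ j) - tail (2 ^+ j.+1)).

Let layers_sum_ge0 k x w :
  0 <= \sum_(j < k) 2 ^+ j.+1 * \1_[set w | 2 ^+ j < sigma x w <= 2 ^+ j.+1] w :> R.
Proof. by rewrite sumr_ge0// => j _; rewrite mulr_ge0. Qed.

Lemma dyadic_layers_ge0 k x w : 0 <= dyadic_layers k x w.
Proof. by rewrite addr_ge0. Qed.

Lemma le_dyadic_layers k x w : sigma x w <= 2 ^+ k -> sigma x w <= dyadic_layers k x w.
Proof.
elim: k => [|k IH] h.
  by rewrite /dyadic_layers big_ord0 addr0 -(expr0 2).
rewrite /dyadic_layers big_ord_recr /= addrA.
have [h'|h'] := leP (sigma x w) (2 ^+ k).
  by apply: le_trans (IH h') _; rewrite lerDl mulr_ge0.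
rewrite indicE mem_set/= ?h' ?h// mulr1 (le_trans h)// lerDr.
exact: dyadic_layers_ge0.
Qed.

Lemma measurable_between x u v : measurable [set w | u < sigma x w <= v].
Proof.
rewrite (_ : [set w | _] = [set w | u < sigma x w] `&` [set w | sigma x w <= v]).
  by apply: measurableI; [exact: measurable_exceed|exact: measurable_not_exceed].
by apply/seteqP; split => w /=; [move=> /andP|move=> [-> ->]].
Qed.

Lemma measurable_dyadic_layers k x : measurable_fun setT (dyadic_layers k x).
Proof.
apply: measurable_funD => //.
rewrite (_ : (fun w => _) = (fun w => \sum_(j <- index_enum 'I_k)
    (2 ^+ j.+1 * \1_[set w | 2 ^+ j < sigma x w <= 2 ^+ j.+1] w)))//.
apply: measurable_sum => j; apply: measurable_funM => //.
by apply: measurable_indic; exact: measurable_between.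
Qed.

Lemma integral_dyadic_layers k x :
  (\int[P]_w (dyadic_layers k x w)%:E = (dyadic_mean k)%:E)%E.
Proof.
pose f (j : 'I_k) w : \bar R :=
  (2 ^+ j.+1 * \1_[set w | 2 ^+ j < sigma x w <= 2 ^+ j.+1] w)%:E.
have mf j : measurable_fun setT (f j).
  apply/measurable_EFinP; apply: measurable_funM => //.
  by apply: measurable_indic; exact: measurable_between.
have f0 j w : (0 <= f j w)%E by rewrite lee_fin mulr_ge0.
transitivity (\int[P]_w (1 + \sum_(j <- index_enum 'I_k) f j w))%E.
  by apply: eq_integral => w _; rewrite /dyadic_layers EFinD sumEFin.
rewrite ge0_integralD//; last 2 first.
- by move=> w _; rewrite sume_ge0.
- exact: emeasurable_sum.
have -> : (\int[P]_(w in setT) 1 = 1)%E.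
  by rewrite integral_cst// mul1e; exact: probability_setT.
rewrite ge0_integral_sum//.
rewrite /dyadic_mean EFinD; congr (_ + _)%E.
rewrite -sumEFin; apply: eq_bigr => j _.
rewrite /f; under eq_integral do rewrite EFinM.
rewrite ge0_integralZl//; last first.
  by apply/measurable_EFinP; apply: measurable_indic; exact: measurable_between.
rewrite integral_indic ?setIT//; last exact: measurable_between.
rewrite EFinM; congr (_ * _)%E; apply: P_between.
by rewrite ler_eXn2l// ltr1n.
Qed.

(** Markov's inequality. *)
Lemma P_dyadic_layers_gt k N (c : R) : 0 < c ->
  (P [set w | (c < \sum_(x < N) dyadic_layers k x w)%R] <= (N%:R * dyadic_mean k / c)%:E)%E.
Proof.
move=> c0; set A := [set w | _].
pose S w : R := \sum_(x <- index_enum 'I_N) dyadic_layers k x w.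
have mS : measurable_fun setT S.
  by apply: measurable_sum => x; exact: measurable_dyadic_layers.
have mA : measurable A.
  have := mS measurableT _ (measurable_itv `]c, +oo[).
  rewrite setTI; congr measurable; apply/seteqP; split => w /=;
    by rewrite in_itv /= andbT.
have S0 w : 0 <= S w by rewrite sumr_ge0// => i _; exact: dyadic_layers_ge0.
have : (c%:E * P A <= \int[P]_w (S w)%:E)%E.
  rewrite -integral_cst//.
  apply: (@le_trans _ _ (\int[P]_(w in A) (S w)%:E)%E).
    apply: ge0_le_integral => //.
    - by move=> w _; rewrite lee_fin ltW.
    - by apply/measurable_EFinP; exact: measurable_funTS.
    - by move=> w /= Aw; rewrite lee_fin ltW.
  apply: ge0_subset_integral => //; first exact/measurable_EFinP.
  by move=> w _; rewrite lee_fin.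
have -> : (\int[P]_w (S w)%:E = (N%:R * dyadic_mean k)%:E)%E.
  transitivity (\int[P]_w (\sum_(x <- index_enum 'I_N) (dyadic_layers k x w)%:E))%E.
    by apply: eq_integral => w _; rewrite sumEFin.
  rewrite ge0_integral_sum//; last 2 first.
  - by move=> x; apply/measurable_EFinP; exact: measurable_dyadic_layers.
  - by move=> x w _; rewrite lee_fin dyadic_layers_ge0.
  under eq_bigr do rewrite integral_dyadic_layers.
  by rewrite sumEFin sumr_const card_ord mulr_natl.
move=> h; rewrite -(@lee_pmul2l _ c%:E) ?lte_fin//; apply: le_trans h _.
by rewrite -EFinM lee_fin mulrCA divff ?mulr1// gt_eqF.
Qed.

(** With [r] the ratio of the tails at [2 ^+ k] and [2 ^+ k.+1], the quotient obeys
    [u' = u * r / 2 + (r - 1)]. Slow variation gives [r --> 1], and [cvg0_contraction] concludes. *)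
Lemma dyadic_mean_ratio_cvg0 :
  (fun k => dyadic_mean k / (2 ^+ k * tail (2 ^+ k))) @ \oo --> (0 : R).
Proof.
have p0 k : 0 < tail (2 ^+ k) by exact: tail_gt0.
have e0 k : 0 < 2 ^+ k :> R by rewrite exprn_gt0.
apply: (@cvg0_contraction _ _ (fun k => tail (2 ^+ k) / tail (2 ^+ k * 2))).
- move=> k; rewrite divr_ge0//; last by rewrite mulr_ge0// ltW.
  rewrite addr_ge0// sumr_ge0// => j _; rewrite mulr_ge0// subr_ge0 tail_le//.
  by rewrite ler_eXn2l// ltr1n.
- by apply: tail_ratio.
- move=> k; have -> : dyadic_mean k.+1 =
      dyadic_mean k + 2 ^+ k.+1 * (tail (2 ^+ k) - tail (2 ^+ k.+1)).
    by rewrite /dyadic_mean big_ord_recr /= addrA.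
  rewrite -exprSr.
  have := p0 k.+1; have := p0 k; have := e0 k.
  move: (tail (2 ^+ k)) (tail (2 ^+ k.+1)) (dyadic_mean k) => a b D; rewrite exprS.
  move: (2 ^+ k) => c h1 h2 h3.
  by field; rewrite !gt_eqF.
Qed.

Lemma P_bigsetU_le (A : nat -> set Omega) M (c : R) :
  (forall i, measurable (A i)) -> (forall i, (P (A i) <= c%:E)%E) ->
  (P (\big[setU/set0]_(i < M) A i) <= (M%:R * c)%:E)%E.
Proof.
move=> mA hA; apply: (le_trans (Boole_inequality P _)) => //.
apply: (@le_trans _ _ (\sum_(i < M) c%:E)%E); first by apply: lee_sum => i _; exact: hA.
by rewrite sumEFin sumr_const card_ord mulr_natl.
Qed.

Lemma bernoulli_inv (q : R) M : 0 < q -> q <= 1 -> (0 < M)%N ->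
  (1 - q) ^+ M <= (M%:R * q)^-1.
Proof.
move=> q0 q1 M0.
have h j : (1 - q) ^+ j * (1 + j%:R * q) <= 1.
  elim: j => [|j IH]; first by rewrite expr0 mul1r mul0r addr0.
  apply: le_trans IH; rewrite exprSr -mulrA ler_wpM2l ?exprn_ge0 ?subr_ge0//.
  rewrite -natr1; have : 0 <= j%:R * q * q by rewrite !mulr_ge0// ltW.
  by have : 0 < q * q; [rewrite mulr_gt0|]; nra.
have Mq : 0 < M%:R * q by rewrite mulr_gt0// ltr0n.
rewrite -[leRHS]mul1r ler_pdivlMr//; apply: le_trans (h M).
by rewrite ler_wpM2l ?exprn_ge0 ?subr_ge0// lerDr.
Qed.

(** The site is the first exceedance of [l], and the four terms of the bound are the probabilities
    of the four ways in which it can fail to dominate its surroundings. *)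
Lemma good_landscape k M m (V delta : R) : 1 <= V -> 0 < delta -> (0 < M)%N ->
  let l := 2 ^+ k in let q := tail l in
  exists B : set Omega, [/\ measurable B,
    (P B <= ((M%:R * q)^-1 + M%:R * (q - tail (l * V)) + M%:R * (m%:R * q ^+ 2) +
             (M + m)%:R * dyadic_mean k / (delta * l))%:E)%E &
    forall w, ~ B w -> exists z, [/\ (z < M)%N,
      (forall y, (y < z)%N -> sigma y w <= l), l * V < sigma z w &
      \sum_(x < z + m | x != z :> nat) sigma x w <= delta * l]].
Proof.
move=> V1 d0 M0 l q.
have l0 : 0 < l by rewrite exprn_gt0.
have lV : l <= l * V by rewrite ler_pMr.
(* Bad events: no exceedance among the first [M] sites; a trap there in the window from [l] to
   [l * V]; a second exceedance within distance [m] to the right of one; an excessive truncated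
   sum. *)
pose E1 := [set w | forall x, (x < M)%N -> sigma x w <= l].
pose E2 := \big[setU/set0]_(x < M) [set w | l < sigma x w <= l * V].
pose E3x x := \big[setU/set0]_(i < m) [set w | l < sigma x w /\ l < sigma (x + i.+1)%N w].
pose E3 := \big[setU/set0]_(x < M) E3x x.
pose E4 := [set w | delta * l < \sum_(x < M + m) dyadic_layers k x w].
have mE1 : measurable E1.
  rewrite (_ : E1 = \bigcap_(x in [set x | (x < M)%N]) [set w | sigma x w <= l])//.
  by apply: bigcap_measurable => [|x _]; [exists 0%N|exact: measurable_not_exceed].
have mE2 : measurable E2.
  by apply: bigsetU_measurable => x _; exact: measurable_between.
have mpair x y : measurable [set w | l < sigma x w /\ l < sigma y w].
  by apply: measurableI; exact: measurable_exceed.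
have mE3x x : measurable (E3x x) by apply: bigsetU_measurable => i _.
have mE3 : measurable E3 by apply: bigsetU_measurable => x _.
have mE4 : measurable E4.
  have : measurable_fun setT (fun w => \sum_(x <- index_enum 'I_(M + m)) dyadic_layers k x w).
    by apply: measurable_sum => x; exact: measurable_dyadic_layers.
  move=> /(_ measurableT _ (measurable_itv `]delta * l, +oo[)).
  rewrite setTI; congr measurable; apply/seteqP; split => w /=;
    by rewrite in_itv /= andbT.
have q0 : 0 < q := tail_gt0 l.
exists (E1 `|` E2 `|` E3 `|` E4); split.
- by do 3 (apply: measurableU => //).
- have hU A B : measurable A -> measurable B -> (P (A `|` B) <= P A + P B)%E.
    exact: measureU2.
  have mE12 : measurable (E1 `|` E2) by apply: measurableU.
  have mE123 : measurable (E1 `|` E2 `|` E3) by apply: measurableU.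
  rewrite 3!EFinD; apply: (le_trans (hU _ _ mE123 mE4)).
  apply: leeD; [apply: (le_trans (hU _ _ mE12 mE3)); apply: leeD;
    [apply: (le_trans (hU _ _ mE1 mE2)); apply: leeD|]|].
  + rewrite P_none_exceed lee_fin bernoulli_inv//; exact: tail_le1.
  + apply: (@P_bigsetU_le (fun x => [set w | l < sigma x w <= l * V])) => x.
      exact: measurable_between.
    by rewrite P_between.
  + apply: (@P_bigsetU_le E3x) => // x.
    apply: (@P_bigsetU_le
      (fun i => [set w | l < sigma x w /\ l < sigma (x + i.+1)%N w])) => // i.
    by rewrite P_two_exceed// -[X in X != _]addn0 eqn_add2l.
  + by apply: P_dyadic_layers_gt; rewrite mulr_gt0.
move=> w nB.
have nE1 : ~ E1 w by move=> h; apply: nB; left; left; left.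
have nE2 x : (x < M)%N -> ~ (l < sigma x w <= l * V).
  move=> xM h; apply: nB; left; left; right.
  by rewrite /E2 -(bigcup_mkord M (fun x => [set w | l < sigma x w <= l * V])); exists x.
have nE3 x i : (x < M)%N -> (i < m)%N -> ~ (l < sigma x w /\ l < sigma (x + i.+1)%N w).
  move=> xM im h; apply: nB; left; right.
  rewrite /E3 -(bigcup_mkord M E3x); exists x => //.
  rewrite /E3x -(bigcup_mkord m
    (fun i => [set w | l < sigma x w /\ l < sigma (x + i.+1)%N w])).
  by exists i.
have nE4 : \sum_(x < M + m) dyadic_layers k x w <= delta * l.
  by rewrite leNgt; apply/negP => h; apply: nB; right.
have ex : exists x, (x < M)%N && (l < sigma x w).
  apply: contrapT => h; apply: nE1 => x xM; rewrite leNgt; apply/negP => lx.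
  by apply: h; exists x; rewrite xM.
have [z /andP[zM lz] zmin] := ex_minnP ex.
have before y : (y < z)%N -> sigma y w <= l.
  move=> yz; rewrite leNgt; apply/negP => ly.
  by have := zmin y; rewrite ly (ltn_trans yz zM) => /(_ isT); rewrite leqNgt yz.
exists z; split => //.
  by rewrite ltNge; apply/negP => h; apply: (nE2 z) => //; rewrite lz.
apply: le_trans nE4.
have zm : (z + m <= M + m)%N by rewrite leq_add2r ltnW.
rewrite (big_ord_widen_cond (M + m) (fun x => x != z) (fun x => sigma x w) zm).
rewrite big_mkcond ler_sum// => x _; case: ifP => [/andP[xz xm]|_]; last first.
  exact: dyadic_layers_ge0.
(* Off [E3] no site of [[0, z + m)] other than [z] exceeds [l], so each is dominated by its dyadic
   layers. *)
apply: le_dyadic_layers; have [xlt|] := ltnP x z; first exact: before.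
rewrite leq_eqVlt eq_sym (negbTE xz) /= => zx.
rewrite leNgt; apply/negP => lx.
apply: (nE3 z (x - z.+1)%N) => //; first by lia.
by split => //; rewrite addnS -addSn subnKC.
Qed.

End Tail.

(** * Localisation *)

(** [btm_prob_lb] with [n = z + m]: the other traps cost [delta], leaving the window costs
    [A / (2 * V)], and reaching [z] too late costs [2 * (C * delta)]. *)
Lemma btm_prob_good (R : realType) (s : nat -> R) z m (l V delta t A C : R) :
  (forall x, 0 < s x) -> 0 < t -> (0 < m)%N -> 0 < l -> 1 <= V -> l * V < s z ->
  0 <= delta -> \sum_(x < z + m | x != z :> nat) s x <= delta * l ->
  t <= A * (l * m%:R) -> z%:R * l <= C * t ->
  1 - (delta + A / (2 * V) + 2 * (C * delta)) <= btm_prob s t z.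
Proof.
move=> s0 t0 m0 l0 V1 lVz d0 sd tA zC.
have V0 : 0 < V by exact: lt_le_trans V1.
have m0R : 0 < m%:R :> R by rewrite ltr0n.
have sz := s0 z.
have zn : (z < z + m)%N by rewrite -[X in (X < _)%N]addn0 ltn_add2l.
have := btm_prob_lb s0 zn t0; apply: le_trans.
have h1 : trap_error s (z + m) z <= delta.
  rewrite /trap_error ler_pdivrMr//; apply: le_trans sd _; rewrite ler_wpM2l//.
  by apply: le_trans (ltW lVz); rewrite ler_pMr.
have h2 : t / (2 * s z * (z + m - z)%:R) <= A / (2 * V).
  have A0 : 0 < A by rewrite -(pmulr_lgt0 _ (mulr_gt0 l0 m0R)) (lt_le_trans t0).
  rewrite addKn ler_pdivrMr ?mulr_gt0//; apply: le_trans tA _.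
  rewrite (_ : A / (2 * V) * _ = A * (s z / V * m%:R)); last by field; rewrite gt_eqF.
  by rewrite ler_wpM2l ?(ltW A0)// ler_wpM2r// ler_pdivlMr// ltW.
have h3 : 2 * (z%:R * \sum_(j < z) s j) / t <= 2 * (C * delta).
  rewrite ler_pdivrMr// -!mulrA ler_wpM2l//.
  apply: (@le_trans _ _ (z%:R * (delta * l))).
    rewrite ler_wpM2l//; apply: le_trans sd.
    rewrite (big_ord_widen (z + m) s (leq_addr m z)) big_mkcond [leRHS]big_mkcond.
    rewrite ler_sum// => x _; case: ifP => [xz|_]; first by rewrite ltn_eqF.
    by case: ifP => // _; rewrite ltW.
  by rewrite mulrCA [C * _]mulrCA ler_wpM2l.
by move: h1 h2 h3; move: (trap_error _ _ _) (t / _) (_ / t) (A / _) (C * _) => *; lra.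
Qed.

(** The default 0 makes the site total; landscapes without an exceedance lie in the bad set of
    [good_landscape]. *)
Definition first_exceed (R : realType) (s : nat -> R) (l : R) : nat :=
  xget 0%N [set z | l < s z /\ forall y, (y < z)%N -> s y <= l].

Lemma first_exceedE (R : realType) (s : nat -> R) (l : R) z :
  l < s z -> (forall y, (y < z)%N -> s y <= l) -> first_exceed s l = z.
Proof.
move=> lz hz; rewrite /first_exceed; case: xgetP => [x _ [lx hx]|h].
  by case: (ltngtP x z) => // [/hz|/hx]; rewrite leNgt ?lx ?lz.
by exfalso; apply: (h z).
Qed.

Section Localisation.
Variables (d : measure_display) (Omega : measurableType d) (R : realType).
Variables (P : probability Omega R) (sigma : nat -> Omega -> R).
Hypothesis sigma_meas : forall x, measurable_fun setT (sigma x).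
Hypothesis sigma_pos : forall x w, 0 < sigma x w.
Hypothesis sigma_indep : iid_indep P sigma.
Hypothesis sigma_ident : ident_distr P sigma.
Hypothesis tail_pos : forall u : R, (0 < P [set w | (u < sigma 0%N w)%R])%E.
Hypothesis L_sv : slowly_varying (tailL P sigma).

(** * Measurability of the localisation site and of the failure event *)

Lemma landscape_first_exceed l n :
  landscape_sigma sigma ((fun w => first_exceed (sigma^~ w) l) @^-1` [set n]).
Proof.
pose G := [set A | exists (x : nat) (B : set R), measurable B /\ A = sigma x @^-1` B].
pose T' : measurableType _ := g_sigma_algebraType G.
change (@measurable _ T' ((fun w => first_exceed (sigma^~ w) l) @^-1` [set n])).
have mB x (B : set R) : measurable B -> @measurable _ T' (sigma x @^-1` B).
  by move=> mB; apply: sub_sigma_algebra; exists x, B.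
pose F z := [set w | l < sigma z w /\ forall y, (y < z)%N -> sigma y w <= l].
have mF z : @measurable _ T' (F z).
  rewrite (_ : F z = (sigma z @^-1` `]l, +oo[%classic) `&`
      \bigcap_y (if (y < z)%N then sigma y @^-1` `]-oo, l]%classic else setT)).
    apply: (@measurableI _ T'); first exact: mB.
    apply: (@bigcapT_measurable _ T') => y; case: ifP => _; first exact: mB.
    exact: (@measurableT _ T').
  apply/seteqP; split => w /=; rewrite in_itv /= andbT => -[h1 h2]; split => // y.
    by move=> _; case: ifP => //= yz; rewrite in_itv /= h2.
  by move=> yz; have := h2 y I; rewrite yz /= in_itv.
(* The fibre over 0 also contains the landscapes without a first exceedance, because of the default
   value. *)
have -> : (fun w => first_exceed (sigma^~ w) l) @^-1` [set n] =
    F n `|` (if n == 0%N then ~` \bigcup_z F z else set0).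
  apply/seteqP; split => w /=.
    rewrite /first_exceed; case: xgetP => [x -> hx <-|h <-]; first by left.
    by right; rewrite eqxx => -[z _ Fz]; apply: (h z).
  move=> [[h1 h2]|]; first exact: first_exceedE.
  case: eqP => [-> h|_ //]; rewrite /first_exceed; case: xgetP => // x _ hx.
  by exfalso; apply: h; exists x.
apply: (@measurableU _ T'); first exact: mF.
case: ifP => _; last exact: (@measurable0 _ T').
by apply: (@measurableC _ T'); exact: (@bigcupT_measurable _ T').
Qed.

Lemma measurable_landscape A : landscape_sigma sigma A -> measurable A.
Proof.
apply: smallest_sub; first exact: sigma_algebra_measurable.
by move=> _ [x [B [mB ->]]]; rewrite -[X in measurable X]setTI; exact: sigma_meas.
Qed.

Lemma measurable_btm_prob t y : 0 <= t ->
  measurable_fun setT (fun w => btm_prob (sigma^~ w) t y).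
Proof.
move=> t0.
apply: (@measurable_fun_cvg _ _ _ _ (fun k w => btm_iter (sigma^~ w) k t 0 y)).
  move=> k.
  apply: (measurableT_comp (f := fun p : Omega * R => btm_iter (sigma^~ p.1) k p.2 0 y)
    (g := fun w => (w, t))).
    exact: measurable_btm_iter.
  exact: measurable_fun_pair.
by move=> w _; exact: cvg_btm_trans.
Qed.

Lemma measurable_not_localised t eps (Z : Omega -> nat) : 0 <= t ->
  (forall n, measurable (Z @^-1` [set n])) ->
  measurable [set w | eps < `|btm_prob (sigma^~ w) t (Z w) - 1| ].
Proof.
move=> t0 mZ.
(* Splitting over the countably many values of [Z] reduces to a fixed site. *)
rewrite (_ : [set w | _] = \bigcup_n (Z @^-1` [set n] `&`
    [set w | eps < `|btm_prob (sigma^~ w) t n - 1| ])).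
  apply: bigcupT_measurable => n; apply: measurableI => //.
  have m : measurable_fun setT (fun w => `|btm_prob (sigma^~ w) t n - 1|).
    apply: measurableT_comp => //; apply: measurable_funB => //.
    exact: measurable_btm_prob.
  have := m measurableT _ (measurable_itv `]eps, +oo[).
  by rewrite setTI; congr measurable; apply/seteqP; split => w /=;
    rewrite in_itv /= andbT.
apply/seteqP; split => w /=; first by move=> h; exists (Z w).
by move=> [n _ [/= ->]].
Qed.

(** * Time scales and the choice of level *)

Let tl := tail P sigma.
(** The trap level [2 ^+ k] times the typical distance [1 / tl (2 ^+ k)] to its first exceedance. *)
Let a k : R := 2 ^+ k / tl (2 ^+ k).

Let tl0 u : 0 < tl u. Proof. exact: tail_gt0. Qed.

Let exp2_gt0 k : 0 < 2 ^+ k :> R. Proof. by rewrite exprn_gt0. Qed.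

Lemma scale_le k k' : (k <= k')%N -> a k <= a k'.
Proof.
move=> kk; rewrite /a ler_pM ?invr_ge0 ?(ltW (exp2_gt0 _)) ?(ltW (tl0 _))//.
  by rewrite ler_eXn2l// ltr1n.
rewrite lef_pV2 ?posrE//; apply: tail_le => //.
by rewrite ler_eXn2l// ltr1n.
Qed.

(** Since [a k >= 2 ^+ k] is unbounded, [lev t] can be the predecessor of the least [k] with
    [t < a k]. *)
Lemma time_scale : exists lev : R -> nat, forall t, a 0 <= t ->
  a (lev t) <= t < a (lev t).+1.
Proof.
have h t : exists k, a 0 <= t -> a k <= t < a k.+1.
  have [a0|] := leP (a 0) t; last by move=> _; exists 0%N.
  have ex : exists k, t < a k.
    have t0 : 0 <= t by apply: le_trans a0; rewrite divr_ge0 ?ltW.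
    exists (Num.bound t); apply: (lt_trans (archi_boundP t0)).
    apply: (@lt_le_trans _ _ (2 ^+ Num.bound t)); first by rewrite -natrX ltr_nat ltn_expl.
    by rewrite ler_peMr ?(ltW (exp2_gt0 _))// invf_ge1// tail_le1.
  have [[|k] tk kmin] := ex_minnP ex; first by rewrite ltNge a0 in tk.
  exists k => _; rewrite tk andbT leNgt; apply/negP => /kmin.
  by rewrite ltnn.
by have [f hf] := choice h; exists f.
Qed.

(** The bound is uniform over the whole time window of level [k], so a limit along levels becomes a
    limit in [t]. *)
Lemma not_localised_small (eps kappa : R) : 0 < eps -> 0 < kappa ->
  \forall k \near \oo, forall t, a k <= t < a k.+1 ->
    (P [set w | (eps < `|btm_prob (sigma^~ w) t
        (first_exceed (sigma^~ w) (2 ^+ k)) - 1|)%R] <= kappa%:E)%E.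
Proof.
move=> eps0 kappa0.
(* Budget: [1 / K] and [(K + 1) * eta] are both [kappa / 4], leaving [kappa / 2] for [rest];
   [delta * (1 + 2 * (K + 1)) = eps / 2], and [V] brings the exit error below [eps / 2]. *)
pose K : R := 4 / kappa; have K0 : 0 < K by rewrite divr_gt0.
have K10 : 0 < K + 1 by rewrite addr_gt0.
pose eta : R := kappa / (4 * (K + 1)); have eta0 : 0 < eta by rewrite divr_gt0// mulr_gt0.
pose delta : R := eps / (2 * (1 + 2 * (K + 1))).
have delta0 : 0 < delta by rewrite divr_gt0// mulr_gt0// addr_gt0// mulr_gt0.
pose V : R := 1 + 4 / (eta * eps).
have V1 : 1 <= V by rewrite lerDl ltW// divr_gt0// mulr_gt0.
have V0 : 0 < V by exact: lt_le_trans V1.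
pose l k : R := 2 ^+ k.
pose h k := dyadic_mean P sigma k / (l k * tl (l k)).
pose rest k := (K + 1) * (1 - tl (l k * V) / tl (l k)) + (K + 1) * tl (l k) +
  (K + eta + 2) / delta * h k.
have rest_cvg : rest @ \oo --> (0 : R).
  rewrite -[X in _ --> X](_ : (K + 1) * (1 - 1^-1) + (K + 1) * 0 +
      (K + eta + 2) / delta * 0 = 0); last by rewrite invr1 subrr !mulr0 !addr0.
  apply: cvgD; [apply: cvgD|].
  - apply: cvgM; first exact: cvg_cst.
    apply: cvgB; first exact: cvg_cst.
    rewrite (_ : (fun k => _) = (fun k => (tl (l k) / tl (l k * V))^-1)).
      apply: cvgV; first exact: oner_neq0.
      exact: tail_ratio.
    by apply/funext => k; rewrite invf_div.
  - by apply: cvgM; [exact: cvg_cst|exact: tail_cvg0].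
  - by apply: cvgM; [exact: cvg_cst|exact: dyadic_mean_ratio_cvg0].
have small : \forall k \near \oo, rest k <= kappa / 2.
  move/cvgrPdist_le : rest_cvg => /(_ (kappa / 2)); rewrite divr_gt0// => /(_ isT).
  by apply: filterS => k; rewrite sub0r normrN => /(le_trans (ler_norm _)).
have ratio2 : \forall k \near \oo, tl (l k) / tl (l k * 2) <= 2.
  have := @tail_ratio _ _ _ P sigma L_sv 2 (ltr0Sn _ _).
  move=> /cvgrPdist_le/(_ 1 ltr01).
  by apply: filterS => k; rewrite ler_norml => /andP[h1 _]; rewrite -/tl -/(l k) in h1; lra.
near=> k => t /andP[at1 at2].
have small_k : rest k <= kappa / 2 by near: k.
have ratio_k : tl (l k) / tl (l k * 2) <= 2 by near: k.
have l0 : 0 < l k := exp2_gt0 k.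
set q := tl (l k); have q0 : 0 < q := tl0 (l k).
have q1 : q <= 1 by exact: tail_le1.
have qi1 : 1 <= q^-1 by rewrite invf_ge1.
have akE : a k = l k / q by [].
have a0 : 0 < a k by rewrite akE divr_gt0.
have t0 : 0 < t by exact: lt_le_trans at1.
(* From [a k] to [a k.+1] the level doubles and the inverse tail grows by a factor at most 2. *)
have t4 : t <= 4 * (l k / q).
  apply: le_trans (ltW at2) _; rewrite /a exprSr -/(l k).
  have q'0 : 0 < tl (l k * 2) by exact: tl0.
  rewrite (_ : _ / _ = 2 * (l k / q) * (q / tl (l k * 2))); last first.
    by field; rewrite !gt_eqF.
  rewrite (_ : 4 * _ = 2 * (l k / q) * 2); last by ring.
  by rewrite ler_wpM2l// mulr_ge0// ltW// divr_gt0.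
(* [M] is the range in which the first exceedance is sought and [m] the clear window after it:
   [K < M * q <= K + 1] and [eta < m * q <= eta + q]. *)
pose M := (Num.trunc (K / q)).+1; pose m := (Num.trunc (eta / q)).+1.
have Kq0 : 0 <= K / q by rewrite divr_ge0// ltW.
have eq0 : 0 <= eta / q by rewrite divr_ge0// ltW.
have /andP[M1 M2] := truncn_itv Kq0; have /andP[m1 m2] := truncn_itv eq0.
have MK : M%:R * q <= K + 1.
  by rewrite -ler_pdivlMr// -natr1 mulrDl lerD// mul1r.
have mK : m%:R * q <= eta + q.
  by rewrite -natr1 mulrDl mul1r lerD2r -ler_pdivlMr.
have KM : K < M%:R * q by rewrite -ltr_pdivrMr.
have [B [mB PB hB]] := good_landscape sigma_meas sigma_indep sigma_ident tail_pos
  k m V1 delta0 (ltn0Sn (Num.trunc (K / q))).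
rewrite -/(l k) -/tl -/q -/M in PB hB.
have {}PB : (P B <= kappa%:E)%E.
  apply: (le_trans PB); rewrite lee_fin.
  have X1 : (M%:R * q)^-1 <= kappa / 4.
    have Mq0 : 0 < M%:R * q := lt_trans K0 KM.
    by rewrite -[leRHS]invf_div -/K lef_pV2 ?posrE//; exact: ltW.
  have X2 : M%:R * (q - tl (l k * V)) <= (K + 1) * (1 - tl (l k * V) / q).
    rewrite (_ : M%:R * _ = M%:R * q * (1 - tl (l k * V) / q)); last first.
      by field; rewrite gt_eqF.
    rewrite ler_wpM2r// subr_ge0 ler_pdivrMr// mul1r tail_le//.
    by rewrite ler_pMr.
  have X3 : M%:R * (m%:R * q ^+ 2) <= (K + 1) * (eta + q).
    rewrite (_ : M%:R * _ = M%:R * q * (m%:R * q)); last by ring.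
    by rewrite ler_pM// mulr_ge0// ltW.
  (* Here [(M + m) * q <= K + 1 + eta + q <= K + eta + 2]. *)
  have X4 : (M + m)%:R * dyadic_mean P sigma k / (delta * l k) <=
      (K + eta + 2) / delta * h k.
    have D0 : 0 <= dyadic_mean P sigma k.
      rewrite addr_ge0// sumr_ge0// => j _; rewrite mulr_ge0// subr_ge0 tail_le//.
      by rewrite ler_eXn2l// ltr1n.
    rewrite (_ : _ / _ * h k = (K + eta + 2) / q * (dyadic_mean P sigma k / (delta * l k))).
      have Dd : 0 <= dyadic_mean P sigma k / (delta * l k).
        by rewrite divr_ge0// mulr_ge0// ltW.
      rewrite -[X in X <= _]mulrA; apply: ler_wpM2r => //.
      by rewrite ler_pdivlMr// natrD mulrDl; lra.
    by rewrite /h -/q; field; rewrite !gt_eqF.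
  have Keta : (K + 1) * eta = kappa / 4 by rewrite /eta; field; rewrite gt_eqF.
  move: X3 small_k; rewrite mulrDr Keta /rest -/q => X3 X5.
  move: X1 X2 X3 X4 X5.
  move: (_^-1) (M%:R * (q - _)) ((K + 1) * (1 - _)) (M%:R * (m%:R * _)) ((K + 1) * q).
  move: (_ / (delta * l k)) ((K + eta + 2) / delta * h k) => *; lra.
apply: le_trans PB; apply: le_measure; rewrite ?inE//.
  apply: measurable_not_localised; first exact: ltW.
  by move=> n; apply: measurable_landscape; exact: landscape_first_exceed.
(* It remains to show that every good landscape localises, with [A = 4 / eta] and [C = K + 1] in
   [btm_prob_good]. *)
move=> w /=; apply: contraPP => /hB[z [zM zb zV zs]].
have lz : l k < sigma z w by apply: le_lt_trans zV; rewrite ler_pMr.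
rewrite (first_exceedE lz zb).
have tA : t <= 4 / eta * (l k * m%:R).
  apply: le_trans t4 _; rewrite -mulrA ler_wpM2l// mulrCA ler_wpM2l ?(ltW l0)//.
  rewrite mulrC ler_pdivlMr// mulrC; exact: ltW.
have zC : z%:R * l k <= (K + 1) * t.
  apply: (@le_trans _ _ ((K + 1) * (l k / q))); last by rewrite ler_wpM2l// ltW.
  rewrite mulrCA mulrC ler_wpM2l ?(ltW l0)// ler_pdivlMr//.
  by apply: le_trans MK; rewrite ler_wpM2r ?(ltW q0)// ler_nat ltnW.
have := btm_prob_good (fun x => sigma_pos x w) t0 (ltn0Sn _) l0 V1 zV (ltW delta0) zs tA zC.
have := btm_trans_le1 (fun x => sigma_pos x w) 0 z (ltW t0).
rewrite -/(btm_prob _ _ _) => p1.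
have Ve : 4 / eta / (2 * V) <= eps / 2.
  rewrite ler_pdivrMr ?mulr_gt0// (_ : eps / 2 * _ = eps * V); last by field.
  rewrite (_ : 4 / eta = eps * (4 / (eta * eps))); last by field; rewrite !gt_eqF.
  by rewrite ler_wpM2l ?(ltW eps0)// lerDr.
have de : delta + 2 * ((K + 1) * delta) = eps / 2.
  rewrite /delta; field; rewrite gt_eqF// addr_gt0// mulr_gt0//.
move=> p2; apply/negP; rewrite -leNgt ler_norml; apply/andP; split; lra.
Unshelve. all: by end_near. Qed.

End Localisation.

Theorem theorem1p1 (d : measure_display) (Omega : measurableType d)
  (R : realType) (P : probability Omega R) (sigma : nat -> Omega -> R)
  (sigma_meas : forall x, measurable_fun setT (sigma x))
  (sigma_pos : forall x w, 0 < sigma x w)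
  (sigma_indep : iid_indep P sigma)
  (sigma_ident : ident_distr P sigma)
  (tail_pos : forall u : R, (0 < P [set w | (u < sigma 0%N w)%R])%E)
  (L_sv : slowly_varying (tailL P sigma)) :
  exists Z : R -> Omega -> nat,
    (forall t (n : nat), landscape_sigma sigma (Z t @^-1` [set n])) /\
    (forall eps : R, 0 < eps ->
       (fun t : R =>
          P [set w | eps < `|btm_prob (fun x => sigma x w) t (Z t w) - 1| ])
       @ +oo --> 0%E).
Proof.
have [lev hlev] := time_scale sigma_meas sigma_ident tail_pos.
pose Z t w := first_exceed (sigma^~ w) (2 ^+ lev t).
have mZ t n : landscape_sigma sigma (Z t @^-1` [set n]).
  exact: landscape_first_exceed.
exists Z; split=> // eps eps0.
have mA t : 0 <= t -> measurable [set w | eps < `|btm_prob (sigma^~ w) t (Z t w) - 1| ].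
  move=> t0; apply: measurable_not_localised => // n.
  exact: measurable_landscape.
apply/fine_cvgP; split.
  (* Measurability of the event is established for [t >= 0], which holds eventually. *)
  by near=> t; apply: fin_num_measure; apply: mA; near: t; apply: nbhs_pinfty_ge; exact: num_real.
apply/cvgrPdist_le => kappa kappa0.
have [k0 _ hk0] := not_localised_small sigma_meas sigma_pos sigma_indep sigma_ident
  tail_pos L_sv eps0 kappa0.
have a_le := @scale_le _ _ _ P sigma sigma_meas sigma_ident tail_pos.
near=> t.
have t0 : 0 <= t by near: t; apply: nbhs_pinfty_ge; exact: num_real.
have ta : 2 ^+ k0 / tail P sigma (2 ^+ k0) <= t by near: t; apply: nbhs_pinfty_ge; exact: num_real.
have /hlev ht := le_trans (a_le _ _ (leq0n k0)) ta.
(* The level diverges with [t]: if [lev t < k0], then [t < a (lev t).+1 <= a k0 <= t]. *)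
have lk : (k0 <= lev t)%N.
  rewrite leqNgt; apply/negP => /a_le h.
  by have /andP[_ /lt_le_trans] := ht; move=> /(_ _ h); rewrite ltNge ta.
have := hk0 _ lk t ht.
rewrite sub0r normrN ger0_norm ?fine_ge0// => h.
by rewrite -lee_fin fineK ?fin_num_measure//; exact: mA.
Unshelve. all: by end_near. Qed.
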